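(* Let $G=(V,E,\omega)$ be a graph with diameter $\Lambda$ and hop-diameter $D$, and let $\tilde G=(\tilde V,\tilde E,\tilde\omega)$ be an $m$-vertex weighted graph embedded in $G$. For any $2\le\kappa\le(\log m)/4$, $1/2>\rho\ge1/\kappa$, $1\le t\le\log\Lambda$ and $0<\epsilon<1$, there is a randomized distributed algorithm in the CONGEST model that computes a $(\beta,\epsilon)$-hopset $H$ for $\tilde G$ with expected size $O(m^{1+1/\kappa}\cdot\log\Lambda)$ in $O\big((D+m^{1+\rho}\cdot\log m\cdot t)\cdot\beta/\rho\cdot\log\Lambda\cdot 2^t/t\big)$ rounds with high probability, where $\beta=O\left(\frac{(\log\kappa+1/\rho)\log\Lambda}{\epsilon\cdot t}\right)^{\log\kappa+1/\rho}$.
   Context: Edge weights are positive integers. $d^{(\beta)}_{G'}(u,v)$ is the minimum length of a $u$–$v$ path in $G'$ with at most $\beta$ edges. $H$ is a $(\beta,\epsilon)$-hopset for $\tilde G$ if $d_{\tilde G}(u,v)\le d^{(\beta)}_{\tilde G\cup H}(u,v)\le(1+\epsilon)d_{\tilde G}(u,v)$ for all $u,v\in\tilde V$. CONGEST model: every vertex of the network $G$ hosts a processor, and in synchronous rounds each vertex can send a message to each of its $G$-neighbors; a message may contain a constant number of vertex/edge identities and edge weights. The hop-diameter $D$ of $G$ is the maximum over pairs of vertices of the minimum number of edges on a path between them. An embedded graph $\tilde G$: $\tilde V\subseteq V$, and every vertex of $V$ knows whether it is in $\tilde V$, and if so, knows its $\tilde G$-neighbors and the weights $\tilde\omega$ of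 its incident $\tilde G$ edges (which need not be related to $G$'s weights). ''With high probability'': probability at least $1-m^{-c}$ for some constant $c>0$. *)

(* Defs.v *)
From HB Require Import structures.
From mathcomp Require Import all_boot all_order all_algebra.
From mathcomp Require Import all_classical all_reals all_analysis.

Set Implicit Arguments.
Unset Strict Implicit.
Unset Printing Implicit Defensive.

Import Order.TTheory GRing.Theory Num.Theory.

Local Open Scope classical_set_scope.
Local Open Scope ring_scope.

Definition log2 {R : realType} (x : R) : R := ln x / ln 2.

(* Simple undirected graphs with positive integer weights; [None] means that
   the pair is not an edge. *)
Record wgraph (V : finType) := WGraph {
  wt :> V -> V -> option nat;
  wt_sym : forall u v, wt u v = wt v u;
  wt_irr : forall v, wt v v = None;
  wt_pos : forall u v w, wt u v = Some w -> (0 < w)%N }.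

Section Graphs.
Variable V : finType.
Implicit Types (G H : wgraph V) (u v : V) (p : seq V).

Definition adj G : rel V := fun u v => isSome (G u v).

Definition edges G : {set {set V}} :=
  [set [set e.1; e.2]%SET | e : V * V & adj G e.1 e.2]%SET.

(* [G] viewed as a graph on the vertex set [U]. *)
Definition graph_on (U : {set V}) G : Prop :=
  forall u v, adj G u v -> (u \in U) && (v \in U).

(* An edge present in both graphs keeps its smaller weight. *)
Definition union_wt G H u v : option nat :=
  match G u v, H u v with
  | Some a, Some b => Some (minn a b)
  | Some a, None => Some a
  | None, b => b
  end.

Lemma union_sym G H u v : union_wt G H u v = union_wt G H v u.
Proof. by rewrite /union_wt (wt_sym G) (wt_sym H). Qed.

Lemma union_irr G H v : union_wt G H v v = None.
Proof. by rewrite /union_wt !wt_irr. Qed.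

Lemma union_pos G H u v w : union_wt G H u v = Some w -> (0 < w)%N.
Proof.
rewrite /union_wt; case EG: (G u v) => [a|]; case EH: (H u v) => [b|] //.
- by case=> <-; rewrite leq_min (wt_pos EG) (wt_pos EH).
- by case=> <-; exact: wt_pos EG.
- by case=> <-; exact: wt_pos EH.
Qed.

Definition gunion G H : wgraph V :=
  WGraph (union_sym G H) (union_irr G H) (@union_pos G H).

(* A path from [u] is given by the list [p] of the vertices that follow [u], so
   it has [size p] edges.  Vertices may repeat, which changes no minimum below
   since weights are positive. *)
Definition is_path G u v p : Prop := path (adj G) u p /\ last u p = v.

Fixpoint path_length G u p : nat :=
  if p is v :: p' then (odflt 0 (G u v) + path_length G v p')%N else 0%N.

Section Distances.
Variable R : realType.
Local Open Scope ereal_scope.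

(* All the distances are [+oo] when there is no path of the required kind. *)
Definition dist G u v : \bar R :=
  ereal_inf [set (path_length G u p)%:R%:E | p in is_path G u v].

Definition hop_dist (b : nat) G u v : \bar R :=
  ereal_inf [set (path_length G u p)%:R%:E
            | p in [set p | is_path G u v p /\ (size p <= b)%N]].

Definition min_hops G u v : \bar R :=
  ereal_inf [set (size p)%:R%:E | p in is_path G u v].

Definition diameter G : \bar R :=
  ereal_sup [set dist G e.1 e.2 | e in [set: V * V]].

Definition hop_diameter G : \bar R :=
  ereal_sup [set min_hops G e.1 e.2 | e in [set: V * V]].

Definition hopset (b : nat) (eps : R) (U : {set V}) G H : Prop :=
  graph_on U H /\
  forall u v, u \in U -> v \in U ->
    dist G u v <= hop_dist b (gunion G H) u v /\
    hop_dist b (gunion G H) u v <= (1 + eps)%:E * dist G u v.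

End Distances.
End Graphs.

(* Vertices carry distinct natural numbers as identities.  A message is a
   sequence of words; the bound on their number and magnitude is
   [legal_message]. *)
Definition message := seq nat.

(* What a vertex knows before the first round: its own identity, the identities
   of its [G]-neighbours with the weights of the edges, whether it belongs to
   the embedded graph, and its neighbours and weights there. *)
Record view := View {
  view_id : nat;
  view_nbrs : seq (nat * nat);
  view_in_sub : bool;
  view_sub_nbrs : seq (nat * nat) }.

(* Every vertex runs the same program, whose local computation is unrestricted,
   on its view and a private random seed.  [alg_send st i] is the message sent
   to the neighbour with identity [i].  [alg_step] receives the incoming
   messages tagged with the identity of their sender.  An output [Some l] means
   that the vertex has decided, irrevocably, that its neighbours in the computed
   graph, with the weights of the edges, are those listed in [l]. *)
Record congest_alg (R : realType) := CongestAlg {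
  alg_seed : finType;
  alg_prob : alg_seed -> R;
  alg_prob_ge0 : forall x, 0 <= alg_prob x;
  alg_prob_sum1 : \sum_x alg_prob x = 1;
  alg_state : Type;
  alg_init : view -> alg_seed -> alg_state;
  alg_send : alg_state -> nat -> message;
  alg_step : alg_state -> seq (nat * message) -> alg_state;
  alg_output : alg_state -> option (seq (nat * nat));
  alg_output_final : forall st inbox l,
    alg_output st = Some l -> alg_output (alg_step st inbox) = Some l }.

Section Execution.
Variables (R : realType) (A : congest_alg R).
Variables (V : finType) (id : V -> nat).
Variables (G : wgraph V) (U : {set V}) (Gt : wgraph V).

(* The finite partial map [f], listed by increasing identity. *)
Definition table (T : Type) (f : V -> option T) : seq (nat * T) :=
  sort (fun a b => (a.1 <= b.1)%N)
       (pmap (fun u => omap (pair (id u)) (f u)) (enum V)).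

Definition local_view (v : V) : view :=
  View (id v) (table (G v)) (v \in U) (table (Gt v)).

Definition seeds : finType := {ffun V -> alg_seed A}.

Fixpoint config (s : seeds) (r : nat) : V -> alg_state A :=
  if r is r'.+1 then
    fun v => alg_step (config s r' v)
      (table (fun u => if adj G u v
                       then Some (alg_send (config s r' u) (id v)) else None))
  else fun v => alg_init (local_view v) (s v).

(* The largest number that is the identity of a vertex or the weight of an
   edge. *)
Definition max_word : nat :=
  maxn (\max_v id v)
       (\max_(e : V * V) maxn (odflt 0%N (G e.1 e.2)) (odflt 0%N (Gt e.1 e.2))).

Definition legal_message (W : nat) (msg : message) : bool :=
  (size msg <= W)%N && all (fun x => (x <= max_word)%N) msg.

Definition respects_bandwidth (W : nat) : Prop :=
  forall s r u v, adj G u v -> legal_message W (alg_send (config s r u) (id v)).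

(* After [r] rounds all vertices have decided, and each one knows exactly its
   incident edges of [H]. *)
Definition computed_by (s : seeds) (r : nat) (H : wgraph V) : Prop :=
  forall v, alg_output (config s r v) = Some (table (H v)).

(* The seeds of distinct vertices are independent. *)
Definition seeds_prob (s : seeds) : R := \prod_v alg_prob (s v).

Definition Prob (E : seeds -> Prop) : R := \sum_(s | `[< E s >]) seeds_prob s.

Definition Expect (X : seeds -> R) : R := \sum_s seeds_prob s * X s.

End Execution.

(* Main.v *)
(* There is a deterministic algorithm whose complexity does not depend on the
   weights of the embedded graph.  It follows the Thorup-Zwick hierarchy
   A_0 = everything, A_1, A_2, ...: at level i each c in A_i is joined to the
   elements of A_i closer than A_(i+1), and to the nearest element of A_(i+1).

   Exact distances cannot be computed in few rounds, so a level works with the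
   metric closure on A_i of the distances realized by few hops.  To see that this
   loses little, cut a walk into maximal stretches that the previous levels cover
   by few hops.  Each break-point is near A_i relatively to the stretch that it
   starts, and among n consecutive break-points one is within O(1/n) of the length
   of the block.  Detours through A_i at these best break-points cost a factor
   1 + O(1/n) over the whole walk, at all scales simultaneously, and leave O(n)
   stretches between consecutive detours.

   Each vertex only needs its k nearest sources, and learns them if in every phase
   each vertex publishes at most k of its own edges to the whole network, by
   flooding.  What is published is known to all, so A_(i+1) is a function of
   public data; it hits the first k elements of every long list, and its
   existence follows from a random choice with k of order m^rho log m. *)

Require Import Defs.
From HB Require Import structures.
From mathcomp Require Import all_boot all_order all_algebra.
From mathcomp Require Import all_classical all_reals all_analysis.
From mathcomp Require Import zify ring lra.

Set Implicit Arguments.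
Unset Strict Implicit.
Unset Printing Implicit Defensive.

Import Order.TTheory GRing.Theory Num.Theory.

Local Open Scope nat_scope.

(** * Walks and connections *)

Section Walks.
Variable T : eqType.
Implicit Types (L : seq (T * T * nat)).

Definition linked L (a b : T) (w : nat) := ((a, b, w) \in L) || ((b, a, w) \in L).

Lemma linked_sym L a b w : linked L a b w = linked L b a w.
Proof. by rewrite /linked orbC. Qed.

Lemma linked_sub L1 L2 a b w :
  {subset L1 <= L2} -> linked L1 a b w -> linked L2 a b w.
Proof. by move=> s12 /orP[/s12|/s12] h; rewrite /linked h ?orbT. Qed.

Lemma linked_cat L1 L2 a b w :
  linked (L1 ++ L2) a b w = linked L1 a b w || linked L2 a b w.
Proof. by rewrite /linked !mem_cat orbACA. Qed.

Inductive walk L : nat -> T -> T -> nat -> Prop :=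
| walk0 a : walk L 0 a a 0
| walkS j a b c w l : linked L a b w -> walk L j b c l -> walk L j.+1 a c (w + l).

Lemma walk_sub L1 L2 j a b l :
  {subset L1 <= L2} -> walk L1 j a b l -> walk L2 j a b l.
Proof.
move=> s12; elim=> [x|n x y z w q lxy _ IH]; first exact: walk0.
by apply: walkS IH; apply: linked_sub lxy.
Qed.

Lemma walk_cat L i j a b c k l :
  walk L i a b k -> walk L j b c l -> walk L (i + j) a c (k + l).
Proof.
elim=> [//|n x y z w q lxy _ IH] /IH; rewrite -addnA addSn.
exact: walkS.
Qed.

Lemma walk_rev L j a b l : walk L j a b l -> walk L j b a l.
Proof.
elim=> [x|n x y z w q lxy _ IH]; first exact: walk0.
have e : walk L 1 y x w.
  by rewrite -[w]addn0; apply: walkS (walk0 _ _); rewrite linked_sym.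
by rewrite addnC -addn1; apply: walk_cat e.
Qed.

(** Hops and length are only bounded above, so both budgets can be weakened by arithmetic and no
    shortest path has to be selected. *)
Definition reach L b x y l := exists j l', [/\ j <= b, l' <= l & walk L j x y l'].

Lemma reach_refl L b x l : reach L b x x l.
Proof. by exists 0, 0; split=> //; exact: walk0. Qed.

Lemma reach_le L b1 b2 x y l1 l2 :
  b1 <= b2 -> l1 <= l2 -> reach L b1 x y l1 -> reach L b2 x y l2.
Proof. by move=> hb hl [j [l [h1 h2 hw]]]; exists j, l; split=> //; lia. Qed.

Lemma reach_sub L1 L2 b x y l :
  {subset L1 <= L2} -> reach L1 b x y l -> reach L2 b x y l.
Proof. by move=> s [j [l' [h1 h2 /(walk_sub s) hw]]]; exists j, l'. Qed.

Lemma reach_trans L b1 b2 x y z l1 l2 :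
  reach L b1 x y l1 -> reach L b2 y z l2 -> reach L (b1 + b2) x z (l1 + l2).
Proof.
move=> [j1 [k1 [h1 h2 w1]]] [j2 [k2 [h3 h4 w2]]].
by exists (j1 + j2), (k1 + k2); split; [lia | lia | apply: walk_cat w1 w2].
Qed.

Lemma reach_sym L b x y l : reach L b x y l -> reach L b y x l.
Proof. by move=> [j [l' [h1 h2 /walk_rev hw]]]; exists j, l'. Qed.

Lemma reach_edge L x y w : linked L x y w -> reach L 1 x y w.
Proof.
move=> h; exists 1, w; split=> //.
by rewrite -[w]addn0; apply: walkS (walk0 _ _).
Qed.

Definition conn L x y l := exists b, reach L b x y l.

Lemma conn_refl L x l : conn L x x l.
Proof. by exists 0; exact: reach_refl. Qed.

Lemma conn_trans L x y z l1 l2 :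
  conn L x y l1 -> conn L y z l2 -> conn L x z (l1 + l2).
Proof. by move=> [b1 r1] [b2 r2]; exists (b1 + b2); apply: reach_trans r1 r2. Qed.

Lemma conn_le L x y l1 l2 : l1 <= l2 -> conn L x y l1 -> conn L x y l2.
Proof. by move=> h [b r]; exists b; apply: reach_le r. Qed.

Lemma conn_sub L1 L2 x y l : {subset L1 <= L2} -> conn L1 x y l -> conn L2 x y l.
Proof. by move=> s [b r]; exists b; apply: reach_sub r. Qed.

Lemma conn_sym L x y l : conn L x y l -> conn L y x l.
Proof. by move=> [b /reach_sym r]; exists b. Qed.

Lemma conn_edge L x y w : linked L x y w -> conn L x y w.
Proof. by move=> /reach_edge r; exists 1. Qed.

(** Serves to show that hopset edges create no shortcut: each of them is replaced by a connection in
    the host graph. *)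
Lemma conn_simulate L1 L2 x y l :
  (forall a b w, linked L1 a b w -> conn L2 a b w) ->
  conn L1 x y l -> conn L2 x y l.
Proof.
move=> h [b [j [l' [_ hl w]]]]; apply: conn_le hl _.
elim: w => [a|n a c d k q /h lac _ IH]; first exact: conn_refl.
exact: conn_trans lac IH.
Qed.

End Walks.

(** * Jumps along a walk *)

Section Hops.
Variable T : eqType.
Variables (G X : seq (T * T * nat)) (A : T -> Prop).
Variables (b K M N n0 kap : nat).

(* The invariant of a level with sources [A]; the stretch is the rational number
   [M / N], which keeps the whole analysis within the natural numbers. *)
Definition close_or_near :=
  forall j x y len, walk G j x y len ->
    (exists2 l, reach X b x y l & N * l <= M * len) \/
    (exists2 z, A z & reach X b x z (K * len)).

(** The stretch of a jump is one that few hops cover, extended by the edge at which coverage fails: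
    hence [b.+1] hops, and hence a source near its starting point. The last stretch is covered up to
    [y]. *)
Inductive jumps : nat -> T -> T -> nat -> Prop :=
| jumps0 x y len l : reach X b x y l -> N * l <= M * len -> jumps 0 x y len
| jumpsS n x x' y len1 len2 l z ln :
    reach X b.+1 x x' l -> N * l <= M * len1 ->
    A z -> reach X b x z ln -> ln <= K * len1 ->
    jumps n x' y len2 -> jumps n.+1 x y (len1 + len2).

Hypotheses (subGX : {subset G <= X}) (NM : N <= M) (n0_gt0 : 0 < n0).
Hypothesis (NK : N * K <= n0 * kap).
Hypothesis inv : close_or_near.

(* [x] is the last stop and [x'] the end of the longest stretch from [x] known to
   be covered by few hops; the next edge is added to it, or a jump ends there. *)
Lemma jumps_extend j x' y len2 : walk G j x' y len2 ->
  forall i x len1 l, walk G i x x' len1 -> reach X b x x' l ->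
  N * l <= M * len1 -> exists n, jumps n x y (len1 + len2).
Proof.
elim=> [a|k a c d w q lac _ IH] i x len1 l wx rx hl.
  by exists 0; rewrite addn0; apply: jumps0 rx hl.
have wxc : walk G (i + 1) x c (len1 + w).
  apply: walk_cat wx _; rewrite -[w]addn0; exact: walkS lac (walk0 _ _).
case: (inv wxc) => [[l' r' hl'] | [z Az rz]].
  by have [n hn] := IH _ _ _ _ wxc r' hl'; exists n; rewrite addnA.
(* The stretch up to [c] is no longer covered, so [x] is near a source. The jump ends at [c], where
   an empty stretch starts; its last edge respects the ratio because [N <= M]. *)
have [n hn] := IH 0 c 0 0 (walk0 _ _) (reach_refl _ _ _ _) (ltac:(lia)).
exists n.+1; rewrite addnA; rewrite add0n in hn.
apply: (jumpsS (l := l + w) _ _ Az rz (leqnn _) hn); last by nia.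
rewrite -addn1; apply: reach_trans rx (reach_edge _).
exact: linked_sub lac.
Qed.

Lemma jumps_of_walk j x y len : walk G j x y len -> exists n, jumps n x y len.
Proof.
move=> w; have := jumps_extend w (walk0 _ _) (reach_refl _ _ _ 0).
by apply; lia.
Qed.

Lemma jumps_short n x y len :
  jumps n x y len -> exists2 l, reach X (n * b.+1 + b) x y l & N * l <= M * len.
Proof.
elim=> [{}x {}y {}len l r h|{}n {}x x' {}y len1 len2 l z ln r h _ _ _ _ [l' r' h']].
  by exists l.
exists (l + l'); last by nia.
by apply: reach_le (reach_trans r r'); lia.
Qed.

(* Among [t.+1] consecutive jumps, the stop nearest to [A] is near relatively
   to the length of all of them. *)
Lemma jumps_block t n x y len : jumps (t.+1 + n) x y len ->
  exists y1 c xB i1 i2 len1 len2 l1 l2 r,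
  [/\ reach X i1 x y1 l1, reach X i2 y1 xB l2, i1 + i2 <= t.+1 * b.+1,
      A c & reach X b y1 c r] /\
  [/\ jumps n xB y len2, N * (l1 + l2) <= M * len1, t.+1 * r <= K * len1 &
      len = len1 + len2].
Proof.
elim: t x len => [|t IH] x len.
  rewrite add1n => J; inversion J as [|k u x' v len1 len2 l z ln r h Az rz hz J']; subst.
  exists x, z, x', 0, b.+1, len1, len2, 0, l, ln; split; split=> //; try lia.
  exact: reach_refl.
rewrite addSn => J; inversion J as [|k u x' v len1 len2 l z ln r h Az rz hz J']; subst.
have [y1 [c [xB [i1 [i2 [m1 [m2 [l1 [l2 [s]]]]]]]]]] := IH _ _ J'.
move=> [[r1 r2 hi Ac rc] [J2 h1 h2 e]].
case: (leqP ln s) => hs.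
  exists x, z, xB, 0, (b.+1 + (i1 + i2)), (len1 + m1), m2, 0, (l + (l1 + l2)), ln.
  split; split=> //; try nia; first exact: reach_refl.
  by apply: reach_trans r (reach_trans r1 r2).
exists y1, c, xB, (b.+1 + i1), i2, (len1 + m1), m2, (l + l1), l2, s.
split; split=> //; try nia.
exact: reach_trans r r1.
Qed.

(** Between the sources of consecutive blocks lie the rest of one block and the beginning of the
    next, at most [n0] jumps each, and two detours of at most [b] hops. *)
Definition chain_hops := (2 * n0 + 2) * b.+1.

Inductive chain : T -> T -> nat -> Prop :=
| chain0 c : chain c c 0
| chainS c d e l l' :
    reach X chain_hops c d l -> A d -> chain d e l' -> chain c e (l + l').

(** Blocks of [n0] jumps are peeled off. Going to the source of a block and back costs [2 * r],
    where [n0 * r <= K * len1] and [N * K <= n0 * kap] give [N * r <= kap * len1]. As each block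
    pays in proportion to its own length, the total loss is [2 * kap] in the numerator, whatever the
    number of blocks. *)
Lemma jumps_chain n x y len : jumps n x y len ->
  (exists2 l, reach X (n0 * b.+1) x y l & N * l <= M * len) \/
  exists c c' l1 l2 l3,
  [/\ A c, A c', reach X (n0 * b.+1 + b) x c l1, chain c c' l2 &
      reach X chain_hops c' y l3 /\
      N * (l1 + l2 + l3) <= (M + 2 * kap) * len].
Proof.
elim/ltn_ind: n x len => n IH x len J.
case: (ltnP n n0) => hn.
  have [l r h] := jumps_short J; left; exists l => //.
  by apply: reach_le r; nia.
right; move: J; rewrite -{1}(subnKC hn) -{1}(prednK n0_gt0) => /jumps_block.
rewrite !(prednK n0_gt0).
move=> [y1 [c [xB [i1 [i2 [len1 [len2 [l1 [l2 [r]]]]]]]]]].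
move=> [[r1 r2 hi Ac rc] [J h1 h2 e]].
have hr : N * r <= kap * len1.
  rewrite -(leq_pmul2l n0_gt0) mulnCA [n0 * (kap * _)]mulnA.
  apply: leq_trans (leq_mul NK (leqnn len1)).
  by rewrite -[N * K * _]mulnA leq_mul2l h2 orbT.
case: (IH _ _ _ _ J) => [|[l rl hl] | [d [d' [k1 [k2 [k3 [Ad Ad' rd ch [rd' hk]]]]]]]].
- by lia.
- exists c, c, (l1 + r), 0, (r + l2 + l); split=> //.
  + by apply: reach_le (reach_trans r1 rc); nia.
  + exact: chain0.
  + split; last by nia.
    apply: reach_le (reach_trans (reach_trans (reach_sym rc) r2) rl) => //.
    by rewrite /chain_hops; nia.
exists c, d', (l1 + r), (r + l2 + k1 + k2), k3; split=> //.
- by apply: reach_le (reach_trans r1 rc); nia.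
- apply: chainS Ad ch.
  apply: reach_le (reach_trans (reach_trans (reach_sym rc) r2) rd) => //.
  by rewrite /chain_hops; nia.
- by split; last nia.
Qed.

Lemma walk_chain j x y len : walk G j x y len ->
  (exists2 l, reach X chain_hops x y l & N * l <= (M + 2 * kap) * len) \/
  exists c c' l1 l2 l3,
  [/\ A c, A c', reach X chain_hops x c l1, chain c c' l2 &
      reach X chain_hops c' y l3 /\
      N * (l1 + l2 + l3) <= (M + 2 * kap) * len].
Proof.
case/jumps_of_walk => n /jumps_chain [[l r h] | [c [c' [l1 [l2 [l3 [Ac Ac' r1 ch h]]]]]]].
  left; exists l; last by nia.
  by apply: reach_le r => //; rewrite /chain_hops; nia.
right; exists c, c', l1, l2, l3; split=> //.
by apply: reach_le r1 => //; rewrite /chain_hops; nia.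
Qed.

End Hops.

(** * Exploration by publishing few edges per vertex *)

(** Greedy choice: take the entry and target with the least [l], then continue among the other
    targets. One [S] works for every [l]: below the minimum the row serves nothing, and above it the
    chosen target counts, by monotonicity. *)
Lemma sel_exists (E Z : eqType) k (row : seq E) (P : E -> Z -> nat -> Prop) :
  (forall e z l l', l <= l' -> P e z l -> P e z l') ->
  exists S : seq E, [/\ {subset S <= row}, size S <= k & forall l,
    (forall e z, e \in row -> P e z l -> exists2 e', e' \in S & P e' z l) \/
    (exists zs : seq Z, [/\ uniq zs, size zs = k &
        forall z, z \in zs -> exists2 e, e \in S & P e z l])].
Proof.
elim: k P => [|k IH] P Pmono.
  by exists [::]; split=> // l; right; exists [::].
have [[l0 [e0 [z0 [re0 P0]]]] | none] :=
    pselect (exists l e z, e \in row /\ P e z l); last first.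
  exists [::]; split=> // l; left=> e z re Pe; case: none; by exists l, e, z.
pose Q l := `[< exists e z, e \in row /\ P e z l >].
have exQ : exists l, Q l by exists l0; apply/asboolP; exists e0, z0.
have [l1 /asboolP[e1 [z1 [re1 P1]]] lmin] := ex_minnP exQ.
have [|S [Srow Sk Ssel]] := IH (fun e z l => P e z l /\ z != z1).
  by move=> e z l l' ll' [/(Pmono _ _ _ _ ll')].
exists (e1 :: S); split=> //.
  by move=> e; rewrite inE => /predU1P[->|/Srow].
move=> l; have [ll1|l1l] := ltnP l l1.
  left=> e z re Pe; have := lmin l; rewrite leqNgt ll1 => /(_ _)/negP[] //.
  by apply/asboolP; exists e, z.
have P1l := Pmono _ _ _ _ l1l P1.
have [Sl | [zs [uzs szs zsP]]] := Ssel l.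
  left=> e z re Pe; have [->|zz1] := eqVneq z z1.
    by exists e1; rewrite ?mem_head.
  have [|e' Se' [Pe' _]] := Sl e z re; first by [].
  by exists e'; rewrite // inE Se' orbT.
right; exists (z1 :: zs); split=> //=; last 2 first.
- by rewrite szs.
- move=> z; rewrite inE => /predU1P[->|/zsP[e Se [Pe _]]].
    by exists e1; rewrite ?mem_head.
  by exists e; rewrite // inE Se orbT.
rewrite uzs andbT; apply/negP => /zsP[e _ [_]]; by rewrite eqxx.
Qed.

Section Truncation.
Variable T : eqType.
Implicit Types (G H X F : seq (T * T * nat)) (A : pred T) (k l : nat).

Definition many X A k v l := exists zs : seq T,
  [/\ uniq zs, size zs = k & forall z, z \in zs -> A z /\ conn X v z l].

(* What a vertex that keeps only its [k] best sources can guarantee about [z]. *)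
Definition found X A k v z l := conn X v z l \/ many X A k v l.

Definition cand X A (e : T * nat) z l :=
  A z /\ exists2 l', conn X e.1 z l' & e.2 + l' <= l.

Definition selects k (row S : seq (T * nat)) X A := forall l,
  (forall e z, e \in row -> cand X A e z l -> exists2 e', e' \in S & cand X A e' z l) \/
  (exists zs : seq T, [/\ uniq zs, size zs = k &
      forall z, z \in zs -> exists2 e, e \in S & cand X A e z l]).

Lemma selects_exists k row X A : exists S : seq (T * nat),
  [/\ {subset S <= row}, size S <= k & selects k row S X A].
Proof.
apply: sel_exists => e z l l' ll' [Az [l1 c h]].
by split=> //; exists l1 => //; exact: leq_trans ll'.
Qed.

Variables (G H : seq (T * T * nat)) (A : pred T) (k h : nat).
(** [F r] stands for the edges of [G] published during the first [r] phases. The edges of [H] are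
    already known to all. *)
Variable F : nat -> seq (T * T * nat).
Hypothesis F_mono : forall r, r < h -> {subset F r <= F r.+1}.
Hypothesis F_sel : forall r v, r < h -> exists row S,
  [/\ forall u w, linked G v u w -> (u, w) \in row,
      forall e, e \in S -> linked (F r.+1) v e.1 e.2 &
      selects k row S (F r ++ H) A].

Let subFH r : r < h -> {subset F r ++ H <= F r.+1 ++ H}.
Proof. by move=> /F_mono s x; rewrite !mem_cat => /orP[/s->|->]//; rewrite orbT. Qed.

(** Induction along the walk, one phase per edge. At an edge of [G], what the neighbour has found is
    a candidate for the current vertex, which publishes an entry at least as good unless its
    selection already yields [k] sources that are as near. *)
Lemma found_walk r j v z l : r <= h -> j <= r ->
  walk (G ++ H) j v z l -> A z -> found (F r ++ H) A k v z l.
Proof.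
elim: r j v z l => [|r IH] j v z l rh jr wv Az.
  case: wv jr => // a _; left; exact: conn_refl.
case: wv Az rh jr => [a|n a u c w q lau wu] Az rh jr.
  by left; exact: conn_refl.
have fu : found (F r ++ H) A k u c q by apply: (IH n) => //; lia.
move: lau; rewrite linked_cat => /orP[lG|lH]; last first.
  have cau : conn (F r.+1 ++ H) a u w.
    by apply: conn_edge; rewrite linked_cat lH orbT.
  case: fu => [cu | [zs [uzs szs zsP]]].
    by left; apply: conn_trans cau (conn_sub (subFH _) cu).
  right; exists zs; split=> // z' /zsP[Az' cz']; split=> //.
  by apply: conn_trans cau (conn_sub (subFH _) cz').
have [row [S [rowP SP sel]]] := F_sel a rh.
have candS e z' : e \in S -> cand (F r ++ H) A e z' (w + q) ->
    conn (F r.+1 ++ H) a z' (w + q).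
  move=> Se [_ [l' cl' hl']]; apply: conn_le hl' _.
  apply: conn_trans (conn_sub (subFH _) cl') => //.
  by apply: conn_edge; rewrite linked_cat SP.
have candu z' : A z' -> conn (F r ++ H) u z' q -> cand (F r ++ H) A (u, w) z' (w + q).
  by move=> Az' cz'; split=> //; exists q.
case: (sel (w + q)) => [all_found | [zs [uzs szs zsP]]]; last first.
  right; exists zs; split=> // z' /zsP[e Se ce]; split; first by case: ce.
  exact: candS ce.
have step z' : A z' -> conn (F r ++ H) u z' q -> conn (F r.+1 ++ H) a z' (w + q).
  move=> Az' /(candu _ Az') /(all_found _ _ (rowP _ _ lG))[e Se ce].
  exact: candS ce.
case: fu => [cu | [zs [uzs szs zsP]]]; first by left; exact: step.
by right; exists zs; split=> // z' /zsP[Az' /(step _ Az')].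
Qed.

Lemma found_chain b n0 c e l : chain_hops b n0 <= h ->
  chain (G ++ H) A b n0 c e l -> found (F h ++ H) A k c e l.
Proof.
move=> hh; elim=> [{}c|{}c d {}e {}l l' [j [m [jb ml wcd]]] Ad _ IH].
  by left; exact: conn_refl.
have fd : found (F h ++ H) A k c d l.
  have [cd | [zs [uzs szs zsP]]] := found_walk (leqnn h) (leq_trans jb hh) wcd Ad.
    by left; exact: conn_le cd.
  right; exists zs; split=> // z /zsP[Az cz]; split=> //; exact: conn_le cz.
case: fd => [cd | [zs [uzs szs zsP]]].
  case: IH => [de | [zs [uzs szs zsP]]]; first by left; exact: conn_trans de.
  right; exists zs; split=> // z /zsP[Az cz]; split=> //; exact: conn_trans cz.
right; exists zs; split=> // z /zsP[Az cz]; split=> //.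
by apply: conn_le cz; lia.
Qed.

End Truncation.

(** * Bunches *)

Section Bunches.
Variable T : eqType.
Implicit Types (L X : seq (T * T * nat)) (A : pred T).

Definition verts L : seq T := undup (flatten [seq [:: e.1.1; e.1.2] | e <- L]).

Lemma linked_verts L a b w : linked L a b w -> (a \in verts L) && (b \in verts L).
Proof.
rewrite !mem_undup => /orP[] h; apply/andP; split; apply/flattenP.
all: by eexists; [apply: (map_f (fun e : T * T * nat => [:: e.1.1; e.1.2])) h
                | rewrite !inE eqxx ?orbT].
Qed.

Lemma conn_verts L a b l : conn L a b l -> a != b ->
  (a \in verts L) && (b \in verts L).
Proof.
move=> [n [j [l' [_ _ w]]]]; elim: w => [c|{}n c d e {}w q lcd _ IH] ce.
  by rewrite eqxx in ce.
have /andP[-> dL] := linked_verts lcd; have [<-//|de] := eqVneq d e.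
by have /andP[_ ->] := IH de.
Qed.

(** The default [0] concerns disconnected pairs, which [by_dst] filters out. *)
Definition dst X c z : nat :=
  if pselect (exists l, `[< conn X c z l >]) is left ex then ex_minn ex else 0.

Lemma dst_le X c z l : conn X c z l -> conn X c z (dst X c z) /\ dst X c z <= l.
Proof.
move=> cz; rewrite /dst; case: pselect => [ex|[]]; last by exists l; apply/asboolP.
by case: ex_minnP => d /asboolP cd dmin; split=> //; apply/dmin/asboolP.
Qed.

Definition members X A := [seq z <- verts X | A z].

Definition by_dst X A c :=
  sort (relpre (dst X c) leq)
    [seq z <- members X A | `[< exists l, conn X c z l >]].

Lemma mem_by_dst X A c z : (z \in by_dst X A c) =
  [&& `[< exists l, conn X c z l >], A z & z \in verts X].
Proof. by rewrite mem_sort !mem_filter. Qed.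

Lemma by_dst_uniq X A c : uniq (by_dst X A c).
Proof. by rewrite sort_uniq !filter_uniq // undup_uniq. Qed.

Lemma size_by_dst X A c : size (by_dst X A c) <= size (members X A).
Proof. by rewrite size_sort size_filter count_size. Qed.

Lemma by_dst_nth X A c i j x0 : i <= j -> j < size (by_dst X A c) ->
  dst X c (nth x0 (by_dst X A c) i) <= dst X c (nth x0 (by_dst X A c) j).
Proof.
move=> ij js.
apply: (sorted_leq_nth (leT := relpre (dst X c) leq)) => //.
- by move=> y x z; apply: leq_trans.
- by move=> x /=.
- by apply: sort_sorted => x y /=; exact: leq_total.
- by rewrite inE (leq_ltn_trans ij js).
Qed.

(** The [.+1] keeps the pivot, that is, the first element of [A'], besides the sources that precede
    it. If there is none, the whole list is kept. *)
Definition bunch X A A' c := take (find A' (by_dst X A c)).+1 (by_dst X A c).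

Definition bunch_edges X A A' :=
  [seq (c, z, dst X c z) | c <- members X A,
                           z <- [seq z <- bunch X A A' c | z != c]].

Lemma bunch_edgesP X A A' c z w : (c, z, w) \in bunch_edges X A A' ->
  [/\ c \in members X A, z \in members X A, c != z, w = dst X c z & conn X c z w].
Proof.
case/allpairsPdep => c' [z' [cm + [-> -> ->]]].
rewrite mem_filter => /andP[zc /mem_take]; rewrite mem_by_dst.
case/and3P => /asboolP[l /dst_le[cz _]] Az zv.
by split=> //; [rewrite mem_filter Az | rewrite eq_sym].
Qed.

Lemma size_bunch_edges X A A' : size (bunch_edges X A A') <=
  \sum_(c <- members X A) (find A' (by_dst X A c)).+1.
Proof.
rewrite size_allpairs_dep sumnE big_map leq_sum // => c _.
rewrite size_filter (leq_trans (count_size _ _)) // size_take.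
by case: ltnP => // /ltnW.
Qed.

Lemma size_bunch_edgesD X A A' : size (bunch_edges X A A') <=
  size (members X A) + \sum_(c <- members X A) find A' (by_dst X A c).
Proof.
apply: leq_trans (size_bunch_edges _ _ _) _.
rewrite (eq_bigr (fun c => 1 + find A' (by_dst X A c))) //.
by rewrite big_split /= sum1_size.
Qed.

Definition pivoted (H : seq (T * T * nat)) (A' : pred T) c l :=
  exists2 p, A' p & p = c \/ exists2 w, w <= l & (c, p, w) \in H.

(** If [z] itself is found, either it precedes the pivot and belongs to the bunch, or the pivot is
    at most as far. If [k] sources are found instead, the list is long, so it is hit among its first
    [k] elements, and the pivot is no farther than the farthest of the [k] sources. *)
Lemma bunch_found X A (A' : pred T) k c z l : 1 < k ->
  (forall c, c \in members X A -> k <= size (by_dst X A c) ->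
     has A' (take k (by_dst X A c))) ->
  A c -> A z -> found X A k c z l ->
  [\/ c = z, exists2 w, w <= l & (c, z, w) \in bunch_edges X A A' |
      pivoted (bunch_edges X A A') A' c l].
Proof.
move=> k1 hits Ac Az fz.
(* A vertex outside [verts X] is connected only to itself, and [1 < k] then excludes [many]. *)
have [cX|cX] := boolP (c \in verts X); last first.
  have isolated y : conn X c y l -> y = c.
    move=> cy; apply/eqP; apply: contraNT cX => yc.
    by rewrite eq_sym in yc; have /andP[] := conn_verts cy yc.
  case: fz => [/isolated <-|[zs [uzs szs zsP]]]; first by constructor 1.
  suff /uniq_leq_size : {subset zs <= [:: c]} by move=> /(_ uzs) /=; lia.
  by move=> y /zsP[_ /isolated ->]; rewrite mem_head.
have cm : c \in members X A by rewrite mem_filter Ac.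
set s := by_dst X A c; set f := find A' s.
have mem_s y : A y -> conn X c y l -> y \in s.
  move=> Ay cy; rewrite mem_by_dst Ay /=; apply/andP; split; first by apply/asboolP; exists l.
  have [<-//|yc] := eqVneq c y; by have /andP[_] := conn_verts cy yc.
have edge i : i <= f -> i < size s -> dst X c (nth c s i) <= l -> nth c s i != c ->
    exists2 w, w <= l & (c, nth c s i, w) \in bunch_edges X A A'.
  move=> hi si hd nc; exists (dst X c (nth c s i)) => //.
  apply: allpairs_f_dep => //; rewrite mem_filter nc /= /bunch -/s -/f.
  by rewrite -(nth_take c (_ : i < f.+1)) ?mem_nth // size_take; case: ifP.
have piv : f < size s -> dst X c (nth c s f) <= l -> pivoted (bunch_edges X A A') A' c l.
  move=> fs hd; exists (nth c s f); first by apply: nth_find; rewrite has_find.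
  have [->|nc] := eqVneq (nth c s f) c; [by left | by right; apply: edge].
case: fz => [cz | [zs [uzs szs zsP]]].
  have [<-|czn] := eqVneq c z; first by constructor 1.
  have zs := mem_s _ Az cz; have is_ : index z s < size s by rewrite index_mem.
  have [if_|fi] := leqP (index z s) f.
    constructor 2; have := edge (index z s) if_ is_; rewrite nth_index //.
    by apply; [exact: (dst_le cz).2 | rewrite eq_sym].
  constructor 3; apply: piv; first exact: ltn_trans is_.
  apply: leq_trans (by_dst_nth c (ltnW fi) is_) _.
  by rewrite nth_index //; exact: (dst_le cz).2.
have ks : k <= size s.
  by rewrite -szs; apply: uniq_leq_size => // y /zsP[Ay /mem_s]; exact.
have fk : f < k.
  have hit := hits c cm ks; rewrite /f -(cat_take_drop k s) find_cat hit.
  by move: hit; rewrite has_find -/s size_takel.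
constructor 3; apply: piv; first exact: leq_trans ks.
(* A pivot beyond [l] would come after all the [k] sources of [zs], but only [f < k] elements
   precede it. *)
rewrite leqNgt; apply/negP => lf.
have sub : {subset zs <= take f s}.
  move=> y /zsP[Ay cy]; have ys := mem_s _ Ay cy.
  have is_ : index y s < size s by rewrite index_mem.
  have [if_|fi] := ltnP (index y s) f.
    by rewrite -(nth_index c ys) -(nth_take c if_) mem_nth // size_take; case: ifP.
  have := leq_trans lf (by_dst_nth c fi is_); rewrite nth_index //.
  by rewrite ltnNge (dst_le cy).2.
have := uniq_leq_size uzs sub; rewrite szs size_take; case: ifP; lia.
Qed.

End Bunches.

(** * One level of the hopset *)

(** The chain between the two extreme sources is replaced by one bunch edge, whence twice
    [chain_hops] plus one. Failing that, the pivot is within [l1 + l2], and [M + 2 * kap <= 2 * N]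
    makes this at most [2 * len]: the new near factor is 2. *)
Lemma level_step (T : eqType) (G F H : seq (T * T * nat)) (A A' : pred T)
    b K M N n0 kap k :
  let X := F ++ H in let H' := bunch_edges X A A' in
  0 < N -> N <= M -> 0 < n0 -> N * K <= n0 * kap -> M + 2 * kap <= 2 * N ->
  close_or_near G (G ++ H) A b K M N ->
  1 < k ->
  (forall c, c \in members X A -> k <= size (by_dst X A c) ->
     has A' (take k (by_dst X A c))) ->
  (forall c e l, A c -> A e -> chain (G ++ H) A b n0 c e l -> found X A k c e l) ->
  close_or_near G (G ++ (H ++ H')) A' (2 * chain_hops b n0).+1 2 (M + 2 * kap) N.
Proof.
move=> X H' N0 NM n00 NK M2 inv k1 hits fch j x y len wxy.
have subGX : {subset G <= G ++ H} by move=> e; rewrite mem_cat => ->.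
have sub : {subset G ++ H <= G ++ (H ++ H')}.
  by move=> e he; rewrite catA mem_cat he.
have edge a c w : (a, c, w) \in H' -> reach (G ++ (H ++ H')) 1 a c w.
  by move=> h; apply: reach_edge; rewrite /linked !mem_cat h !orbT.
have [[l r hl] | ] := walk_chain subGX NM n00 NK inv wxy.
  left; exists l => //; apply: reach_le (reach_sub sub r) => //; lia.
move=> [c [c' [l1 [l2 [l3 [Ac Ac' r1 ch [r3 hl]]]]]]].
have hl2 : l1 + l2 + l3 <= 2 * len.
  rewrite -(leq_pmul2l N0); apply: leq_trans hl _.
  by rewrite mulnA [N * 2]mulnC leq_mul.
case: (bunch_found k1 hits Ac Ac' (fch _ _ _ Ac Ac' ch)) => [e | [w wl /edge e] | [p A'p pP]].
- left; exists (l1 + l3); last by nia.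
  rewrite -e in r3; apply: reach_le (reach_sub sub (reach_trans r1 r3)) => //; lia.
- left; exists (l1 + (w + l3)); last by nia.
  apply: reach_le (reach_trans (reach_sub sub r1) _) => //; last first.
    exact: reach_trans e (reach_sub sub r3).
  lia.
- right; exists p => //; case: pP => [->|[w wl /edge e]].
    apply: reach_le (reach_sub sub r1); lia.
  apply: reach_le (reach_trans (reach_sub sub r1) e); lia.
Qed.

(** * Hitting sets by derandomization *)

(** Writes [find] as a sum of avoidance indicators, the form that [derandomize] handles. *)
Lemma sum_avoid_prefix (T : Type) (a : pred T) (s : seq T) :
  \sum_(i < size s) ~~ has a (take i.+1 s) = find a s.
Proof.
elim: s => [|x s IH] /=; first by rewrite big_ord0.
rewrite big_ord_recl /= take0 /= orbF; case: (a x) => /=.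
  by rewrite big1.
by rewrite IH.
Qed.

Section Sampling.
Variable R : realType.
Local Open Scope ring_scope.

(* The method of conditional expectations for a random subset of [s] that
   contains each element independently with probability [p]. *)
Lemma derandomize (T : eqType) (p x : R) (s : seq T) (r : seq (pred T * R)) :
  0 <= p <= 1 -> exists2 S : seq T, {subset S <= s} &
  x * (size S)%:R + \sum_(j <- r) j.2 * (~~ has j.1 S)%:R <=
  (size s)%:R * p * x + \sum_(j <- r) j.2 * (1 - p) ^+ count j.1 s.
Proof.
move=> /andP[p0 p1]; elim: s r => [|e s IH] r.
  exists [::] => //=; rewrite mulr0 !mul0r !add0r.
  by apply: ler_sum.
(* [S1] continues the choice of taking [e], which cancels the penalties of the predicates true at
   [e]; [S2] continues the choice of leaving [e] out. *)
have [S1 S1s h1] := IH [seq (j.1, j.2 * (~~ j.1 e)%:R) | j <- r].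
have [S2 S2s h2] := IH r.
rewrite !big_map /= in h1.
set s1 := (\sum_(j <- r) _ * (1 - p) ^+ _) in h1.
set s2 := (\sum_(j <- r) _ * (1 - p) ^+ _) in h2.
have -> : \sum_(j <- r) j.2 * (1 - p) ^+ count j.1 (e :: s) =
    p * s1 + (1 - p) * s2.
  rewrite !mulr_sumr -big_split; apply: eq_bigr => j _ /=.
  by case: (j.1 e) => /=; rewrite ?add0n ?add1n ?exprS; ring.
(* The target is the average of these two values with weights [p] and [1 - p], so the smaller one is
   below it. *)
have [le12 | le21] := lerP (x + ((size s)%:R * p * x + s1)) ((size s)%:R * p * x + s2).
  exists (e :: S1).
    by move=> z; rewrite !inE => /predU1P[->|/S1s->]; rewrite ?eqxx ?orbT.
  have -> : \sum_(j <- r) j.2 * (~~ has j.1 (e :: S1))%:R =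
      \sum_(j <- r) j.2 * (~~ j.1 e)%:R * (~~ has j.1 S1)%:R.
    by apply: eq_bigr => j _ /=; case: (j.1 e); rewrite ?mulr0 ?mul0r ?mulr1.
  rewrite /= !mulrS; nra.
exists S2; first by move=> z /S2s; rewrite inE orbC => ->.
by rewrite /= !mulrS; nra.
Qed.

(** Bounds by [1 / p] the expected number of elements that precede the first sampled one. *)
Lemma sum_geometric (p : R) n : 0 <= p <= 1 ->
  p * (\sum_(i < n) (1 - p) ^+ i.+1) <= 1 - (1 - p) ^+ n.
Proof.
move=> /andP[p0 p1]; elim: n => [|n IH]; first by rewrite big_ord0 expr0; lra.
rewrite big_ord_recr /= mulrDr exprS.
have q0 : 0 <= (1 - p) ^+ n by rewrite exprn_ge0 //; lra.
nra.
Qed.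

(* The bound [3] on each quantity comes from a total expectation below
   [1 + 1 + 1], unhit long lists being charged [4]. *)
Lemma hitting_set (T : eqType) (s : seq T) (sig : T -> seq T) (k : nat) (p : R) :
  uniq s -> (forall c, c \in s -> uniq (sig c) /\ {subset sig c <= s}) ->
  0 < p <= 1 -> 4 * (size s)%:R * (1 - p) ^+ k < 1 ->
  exists S : seq T,
  [/\ {subset S <= s}, (size S)%:R <= 3 * p * (size s)%:R,
      (\sum_(c <- s) find (mem S) (sig c))%:R <= 3 * (size s)%:R / p &
      forall c, c \in s -> (k <= size (sig c))%N -> has (mem S) (take k (sig c))].
Proof.
move=> us sigP /andP[p0 p1] hk.
have [/size0nil->|n_gt0] := posnP (size s).
  by exists [::]; rewrite big_nil; split=> //=; rewrite !mulr0 ?mul0r.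
set n := size s.
have n0 : 0 < n%:R :> R by rewrite ltr0n.
(* [r1] charges [p / n] for each prefix that [S] avoids, [r2] charges 4 for each long list whose
   first [k] elements are avoided, and the size is charged [1 / (p * n)] per element. *)
pose r1 := [seq (mem (take i.+1 (sig c)) : pred T, p / n%:R) |
             c <- s, i <- iota 0 (size (sig c))].
pose r2 := [seq (mem (take k (sig c)) : pred T, 4 : R) |
             c <- [seq c <- s | (k <= size (sig c))%N]].
have p01 : 0 <= p <= 1 by rewrite ltW.
have [S Ss] := derandomize (p * n%:R)^-1 s (r1 ++ r2) p01.
rewrite !big_cat /=.
have countE c i : c \in s ->
    count (mem (take i (sig c))) s = minn i (size (sig c)).
  move=> /sigP[uc subc]; rewrite -size_filter -size_take_min.
  apply/perm_size/uniq_perm; rewrite ?filter_uniq ?take_uniq // => z.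
  by rewrite mem_filter /= andb_idr // => /mem_take/subc.
have e1 : \sum_(j <- r1) j.2 * (~~ has j.1 S)%:R =
    p / n%:R * (\sum_(c <- s) find (mem S) (sig c))%:R.
  rewrite big_allpairs_dep /= natr_sum mulr_sumr; apply: eq_bigr => c _.
  rewrite -sum_avoid_prefix natr_sum mulr_sumr.
  rewrite -(big_mkord xpredT (fun i => p / n%:R * (~~ has (mem S) (take i.+1 (sig c)))%:R)).
  by rewrite /index_iota subn0; apply: eq_bigr => i _; rewrite has_sym.
have b1 : \sum_(j <- r1) j.2 * (1 - p) ^+ count j.1 s <= 1.
  rewrite big_allpairs_dep /= big_seq.
  have e2 : 1 = \sum_(c <- s | c \in s) n%:R^-1 :> R.
    rewrite -big_seq big_const_seq count_predT iter_addr_0 -[RHS]mulr_natr.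
    by rewrite mulVf // gt_eqF.
  rewrite [leRHS]e2; apply: ler_sum => c cs.
  rewrite -{1}[size (sig c)]subn0 -/(index_iota 0 _).
  rewrite big_mkord.
  rewrite (eq_bigr (fun i : 'I_ _ => n%:R^-1 * (p * (1 - p) ^+ i.+1))); last first.
    move=> i _; rewrite countE //; move: (ltn_ord i) => /minn_idPl->.
    by rewrite mulrA [_ * p]mulrC.
  rewrite -!mulr_sumr ler_piMr ?invr_ge0 ?ler0n //.
  apply: le_trans (sum_geometric _ p01) _.
  by rewrite lerBlDr lerDl exprn_ge0 // subr_ge0.
have b2 : \sum_(j <- r2) j.2 * (1 - p) ^+ count j.1 s < 1.
  rewrite big_map big_filter /=; apply: le_lt_trans hk.
  rewrite big_seq_cond.
  apply: (@le_trans _ _ (\sum_(c <- s | (c \in s) && (k <= size (sig c))%N) 4 * (1 - p) ^+ k)).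
    apply: ler_sum => c /andP[cs ks]; rewrite countE //.
    by move: ks => /minn_idPl->.
  rewrite big_const_seq iter_addr_0 -[leLHS]mulr_natr [leRHS]mulrAC.
  apply: ler_wpM2l; last by rewrite ler_nat count_size.
  by rewrite mulr_ge0 // exprn_ge0 // subr_ge0.
have g2 : 0 <= \sum_(j <- r2) j.2 * (~~ has j.1 S)%:R.
  by rewrite big_map; apply: sumr_ge0 => c _; rewrite mulr_ge0.
rewrite e1.
have -> : n%:R * p * (p * n%:R)^-1 = 1.
  by rewrite [n%:R * p]mulrC mulfV // mulf_neq0 // gt_eqF.
set F := (\sum_(c <- s) _)%:R; move=> hS.
have F0 : 0 <= p / n%:R * F by rewrite mulr_ge0 // divr_ge0 // ltW.
have S0 : 0 <= (p * n%:R)^-1 * (size S)%:R.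
  by rewrite mulr_ge0 // invr_ge0 mulr_ge0 // ltW.
exists S; split=> //.
- have : (p * n%:R)^-1 * (size S)%:R <= 3 by lra.
  by rewrite ler_pdivrMl ?mulr_gt0 // => /le_trans; apply; lra.
- have : p / n%:R * F <= 3 by lra.
  rewrite -[p / _]invf_div ler_pdivrMl ?divr_gt0 //; lra.
- move=> c cs ks; apply: contraT => nh.
  have : 4 <= \sum_(j <- r2) j.2 * (~~ has j.1 S)%:R; last by lra.
  rewrite big_map (big_rem c) /=; last by rewrite mem_filter ks.
  rewrite has_sym in nh; rewrite nh mulr1 lerDl.
  by apply: sumr_ge0 => d _; rewrite mulr_ge0.
Qed.

End Sampling.

(** * Flooding in the CONGEST model *)

Notation fact := (nat * nat * nat)%type.

Lemma mem_table (V : finType) (id : V -> nat) (T : eqType) (f : V -> option T) e :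
  reflect (exists2 u, id u = e.1 & f u = Some e.2) (e \in table id f).
Proof.
rewrite mem_sort; apply: (iffP idP) => [|[u uid fu]].
  rewrite mem_pmap => /mapP[u _]; case fu: (f u) => [y|] //= [->].
  by exists u.
rewrite mem_pmap; apply/mapP; exists u; rewrite ?mem_enum //.
by rewrite fu /= uid; case: e {fu uid}.
Qed.

(** Vertices learn the same facts in different orders; sorting gives all of them the same input for
    [pub_upd]. *)
Definition canon (K : seq fact) := sort (relpre pickle leq) K.

Lemma canon_eq K1 K2 : uniq K1 -> uniq K2 -> K1 =i K2 -> canon K1 = canon K2.
Proof.
move=> u1 u2 e; apply/perm_sortP; last exact: uniq_perm.
- by move=> x y; exact: leq_total.
- by move=> y x z; exact: leq_trans.
- by move=> x y /= /anti_leq /(pcan_inj pickleK).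
Qed.

Definition decode (inbox : seq (nat * message)) : seq fact :=
  pmap (fun e => if e.2 is [:: a; b; w] then Some (a, b, w) else None) inbox.

(** New facts go to the end, so the prefix that has been forwarded never changes. *)
Definition learn (K L : seq fact) := K ++ undup [seq f <- L | f \notin K].

Lemma mem_learn K L f : (f \in learn K L) = (f \in K) || (f \in L).
Proof. by rewrite mem_cat mem_undup mem_filter; case: (f \in K). Qed.

Lemma learn_uniq K L : uniq K -> uniq (learn K L).
Proof.
move=> uK; rewrite cat_uniq uK undup_uniq andbT /=.
by apply/hasPn => f; rewrite mem_undup mem_filter => /andP[].
Qed.

Lemma take_learn K L c : c <= size K -> take c (learn K L) = take c K.
Proof.
move=> cK; rewrite take_cat; case: ltngtP cK => // ->.
by rewrite subnn take0 cats0 take_size.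
Qed.

Lemma take_sub (T : eqType) (s : seq T) i j : i <= j -> {subset take i s <= take j s}.
Proof. by move=> ij x; rewrite -(subnKC ij) takeD mem_cat => ->. Qed.

(* Protocols in which each vertex publishes, at the beginning of each phase, some
   of its incident edges, chosen from a state that is common to all vertices. *)
Record publication := Publication {
  pub_type : Type;
  pub_start : pub_type;
  pub_sel : pub_type -> nat -> seq (nat * nat) -> seq fact;
  pub_upd : pub_type -> seq fact -> pub_type;
  pub_out : pub_type -> nat -> seq (nat * nat);
  pub_sel_own : forall q v row,
    {subset pub_sel q v row <= [seq (v, e.1, e.2) | e <- row]} }.

Arguments pub_start : clear implicits.
Arguments pub_sel : clear implicits.
Arguments pub_upd : clear implicits.
Arguments pub_out : clear implicits.

(* [st_known] lists the known facts by order of arrival; the first [st_sent] of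
   them have been forwarded to all neighbours. *)
Record flood_state (Q : Type) := FloodState {
  st_id : nat;
  st_row : seq (nat * nat);
  st_pub : Q;
  st_phase : nat;
  st_round : nat;
  st_known : seq fact;
  st_sent : nat }.

Section Flooding.
Variables (R : realType) (B : publication) (P T : nat).
Let state := flood_state (pub_type B).

Definition flood_init (vw : view) (x : unit) : state :=
  FloodState (view_id vw) (view_sub_nbrs vw) (pub_start B) 0 0
    (learn [::] (pub_sel B (pub_start B) (view_id vw) (view_sub_nbrs vw))) 0.

Definition flood_send (st : state) (i : nat) : message :=
  if onth (st_known st) (st_sent st) is Some (a, b, w) then [:: a; b; w] else [::].

(** [c'] is bounded by the size of the list before the round, from which the message of the round
    was taken. After [P] phases the state is frozen, which makes outputs final. *)
Definition flood_step (st : state) (inbox : seq (nat * message)) : state :=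
  if P <= st_phase st then st else
  let: FloodState i row q p r K c := st in
  let K' := learn K (decode inbox) in
  let c' := minn c.+1 (size K) in
  if r.+1 == T then
    let q' := pub_upd B q (canon K') in
    FloodState i row q' p.+1 0 (learn K' (pub_sel B q' i row)) c'
  else FloodState i row q p r.+1 K' c'.

Definition flood_output (st : state) : option (seq (nat * nat)) :=
  if P <= st_phase st then Some (pub_out B (st_pub st) (st_id st)) else None.

Lemma flood_output_final st inbox l :
  flood_output st = Some l -> flood_output (flood_step st inbox) = Some l.
Proof. by rewrite /flood_output /flood_step; case: leqP => // h; rewrite h. Qed.

Fact unit_prob_ge0 (x : unit) : (0 <= 1 :> R)%R. Proof. exact: ler01. Qed.

Fact unit_prob_sum1 : (\sum_(x : unit) 1 = 1 :> R)%R.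
Proof. by rewrite big_const card_unit /= addr0. Qed.

Definition flood_alg : congest_alg R :=
  @CongestAlg R unit (fun=> 1%R) unit_prob_ge0 unit_prob_sum1 state
    flood_init flood_send flood_step flood_output flood_output_final.

Variables (V : finType) (id : V -> nat) (G : wgraph V) (U : {set V}) (Gt : wgraph V).
Variable s : seeds flood_alg V.
Let row v := table id (Gt v).
Let conf r v : state := config id G U Gt s r v.

Definition sub_fact (f : fact) :=
  exists x y w, Gt x y = Some w /\ f = (id x, id y, w).

Lemma sel_sub_fact q v f : f \in pub_sel B q (id v) (row v) -> sub_fact f.
Proof.
move=> /pub_sel_own/mapP[e /mem_table[y yid e2] ->].
by exists v, y, e.2; rewrite e2 yid.
Qed.

Let inbox r v := table id (fun u => if adj G u v
  then Some (flood_send (conf r u) (id v)) else None).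

Lemma conf_step r v : conf r.+1 v = flood_step (conf r v) (inbox r v).
Proof. by []. Qed.

Lemma decode_inbox r v f : f \in decode (inbox r v) <->
  exists2 u, adj G u v & onth (st_known (conf r u)) (st_sent (conf r u)) = Some f.
Proof.
rewrite /decode mem_pmap; split.
  move=> /mapP[[i msg] /mem_table[u /= _]]; case: ifP => // uv [<-].
  rewrite /flood_send; case e: (onth _ _) => [[[a b] w]|] //= [->].
  by exists u.
move=> [u uv e]; apply/mapP; exists (id u, flood_send (conf r u) (id v)).
  by apply/mem_table; exists u => //=; rewrite uv.
by rewrite /flood_send e /=; case: f {e} => [[]].
Qed.

Lemma onth_mem (X : eqType) (t : seq X) i x : onth t i = Some x -> x \in t.
Proof.
elim: t i => [|y t IH] [|i] //= => [[->]|/IH]; rewrite inE ?eqxx // => ->.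
by rewrite orbT.
Qed.

Lemma conf_static r v :
  [/\ st_id (conf r v) = id v, st_row (conf r v) = row v &
      forall f, f \in st_known (conf r v) -> sub_fact f].
Proof.
elim: r v => [|r IH] v.
  split=> // f; rewrite mem_learn /=; exact: sel_sub_fact.
have [] := IH v; rewrite conf_step /flood_step.
have dec f : f \in decode (inbox r v) -> sub_fact f.
  by move=> /decode_inbox[u _ /onth_mem]; have [_ _] := IH u; exact.
case: (conf r v) => i rw q p t K c /= -> -> Kok.
case: ifP => //= _; case: ifP => /= _; split=> // f; rewrite !mem_learn.
  by case/orP => [/orP[/Kok|/dec]|/sel_sub_fact].
by case/orP => [/Kok|/dec].
Qed.

Fixpoint ball d (u w : V) : Prop :=
  if d is d'.+1 then u = w \/ exists2 u', adj G u u' & ball d' u' w else u = w.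

Definition own q v := pub_sel B q (id v) (row v).

(** The centralized execution that every vertex is shown to simulate. *)
Fixpoint public p : pub_type B * seq fact :=
  if p is p'.+1 then
    let: (q, K) := public p' in
    let K' := canon (undup (K ++ flatten [seq own q v | v <- enum V])) in
    (pub_upd B q K', K')
  else (pub_start B, [::]).

Definition fresh p := flatten [seq own (public p).1 v | v <- enum V].

Lemma publicS p : public p.+1 =
  let K' := canon (undup ((public p).2 ++ fresh p)) in
  (pub_upd B (public p).1 K', K').
Proof. by rewrite /fresh /=; case: (public p). Qed.

Lemma public_uniq p : uniq (public p).2.
Proof. by case: p => // p; rewrite publicS sort_uniq undup_uniq. Qed.

Lemma mem_publicS p f : (f \in (public p.+1).2) = (f \in (public p).2) || (f \in fresh p).
Proof. by rewrite publicS mem_sort mem_undup mem_cat. Qed.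

Lemma freshP p f : reflect (exists v, f \in own (public p).1 v) (f \in fresh p).
Proof.
apply: (iffP flattenP) => [[_ /mapP[v _ ->] h] | [v h]]; first by exists v.
by exists (own (public p).1 v) => //; apply: map_f; rewrite mem_enum.
Qed.

Variables D k : nat.
Hypothesis own_out : forall v, v \notin U -> row v = [::].
Hypothesis sel_size : forall q v rw, size (pub_sel B q v rw) <= k.
Hypothesis hopD : forall u w, ball D u w.
Hypothesis T_large : D + #|U| * k + 2 <= T.

Lemma size_fresh p : size (fresh p) <= #|U| * k.
Proof.
rewrite size_flatten /shape -map_comp sumnE big_map big_enum /=.
rewrite (bigID (mem U)) /= [X in _ + X]big1 ?addn0; last first.
  move=> v vU; case e: (own _ v) => [//|f t].
  have : f \in own (public p).1 v by rewrite e mem_head.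
  by move=> /pub_sel_own; rewrite own_out.
by rewrite -sum_nat_const leq_sum // => v _; exact: sel_size.
Qed.

Definition vertex_inv p t r v :=
  let st := conf r v in let K := st_known st in let c := st_sent st in
  let old := (public p).2 in
  [/\ st_pub st = (public p).1, st_phase st = p & st_round st = t] /\
  [/\ uniq K, c <= size K, {subset old <= take c K}, {subset own (public p).1 v <= K} &
      {subset K <= old ++ fresh p}].

(* Forwarding in an arbitrary order is enough: a vertex that has not forwarded
   all the facts published within distance [d] has been busy since round [d]. *)
Definition flood_inv p t r := forall v,
  let K := st_known (conf r v) in let c := st_sent (conf r v) in
  [/\ vertex_inv p t r v,
      forall u, adj G u v -> {subset take (st_sent (conf r u)) (st_known (conf r u)) <= K} &
      forall d, (forall x w, ball d v w -> x \in own (public p).1 w -> x \in take c K) \/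
                size (public p).2 + (t - d) <= c].

Lemma size_old p t r v : vertex_inv p t r v -> size (public p).2 <= st_sent (conf r v).
Proof.
move=> [_ [_ cK old _ _]]; apply: leq_trans (uniq_leq_size (public_uniq p) old) _.
by rewrite size_takel.
Qed.

Lemma adjC u v : adj G u v = adj G v u.
Proof. by rewrite /adj wt_sym. Qed.

Lemma onth_take (X : eqType) (t : seq X) i x :
  x \in take i.+1 t -> x \in take i t \/ onth t i = Some x.
Proof.
elim: t i => [|y t IH] [|i] //=; rewrite inE.
  by rewrite take0 orbF => /eqP->; right.
by case/predU1P => [->|/IH[h|->]]; rewrite ?inE ?eqxx ?h ?orbT; [left|left|right].
Qed.

(** For the greedy clause, suppose that [v] has nothing left to send and look at its neighbour [u]
    on the way to [w]. Either [u] has forwarded the facts of [w], so [v] has them, or [u] has been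
    busy since round [d]; all that [u] sent is known to [v], which has then sent enough itself. *)
Lemma flood_round p t r : flood_inv p t r -> forall v,
  let K := st_known (conf r v) in
  let K' := learn K (decode (inbox r v)) in
  let c' := minn (st_sent (conf r v)).+1 (size K) in
  [/\ [/\ uniq K', c' <= size K, {subset (public p).2 <= take c' K},
          {subset own (public p).1 v <= K'} & {subset K' <= (public p).2 ++ fresh p}],
      forall u, adj G u v ->
        {subset take (minn (st_sent (conf r u)).+1 (size (st_known (conf r u))))
           (st_known (conf r u)) <= K'} &
      forall d, (forall x w, ball d v w -> x \in own (public p).1 w -> x \in take c' K) \/
                size (public p).2 + (t.+1 - d) <= c'].
Proof.
move=> inv v /=; have [vi nb greedy] := inv v.
have so := size_old vi.
case: vi => _ [uK cK oldK ownK Ksub].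
set K := st_known (conf r v) in uK cK oldK ownK Ksub nb greedy *.
set c := st_sent (conf r v) in so cK oldK greedy *.
have cc' : c <= minn c.+1 (size K) by rewrite leq_min leqnSn.
split.
- split.
  + exact: learn_uniq.
  + exact: geq_minr.
  + by move=> x /oldK/(take_sub cc').
  + by move=> x /ownK h; rewrite mem_learn h.
  + move=> x; rewrite mem_learn => /orP[/Ksub//|/decode_inbox[u uv /onth_mem]].
    by have [[_ [_ _ _ _ h]] _ _] := inv u; exact: h.
- move=> u uv x xu; rewrite mem_learn.
  have /onth_take : x \in take (st_sent (conf r u)).+1 (st_known (conf r u)).
    by apply: (take_sub _ xu); exact: geq_minl.
  case=> [/(nb u uv)->//|e]; apply/orP; right; apply/decode_inbox.
  by exists u; rewrite // adjC.
- move=> d; have [h|lt] := leqP (size (public p).2 + (t.+1 - d)) (minn c.+1 (size K)).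
    by right.
  left=> x w bw xw; have [old_|busy] := greedy d.
    exact: take_sub cc' _ (old_ _ _ bw xw).
  (* With a fact left to send, the counter would have grown by one and kept up with the bound. *)
  have ec : c = size K.
    apply/eqP; rewrite eqn_leq cK leqNgt; apply/negP => cltK.
    by move: lt; rewrite (minn_idPl cltK); lia.
  have eK : take (minn c.+1 (size K)) K = K.
    by rewrite ec (minn_idPr (leqnSn _)) take_size.
  rewrite eK; move: lt; rewrite ec (minn_idPr (leqnSn _)) => lt.
  case: d bw lt busy => [vw _ _|d]; first by apply: ownK; rewrite vw.
  rewrite subSS => -[vw _ _|[u vu bu] lt _]; first by apply: ownK; rewrite vw.
  have [[_ [uKu cKu _ _ _]] _ /(_ d)[old_|busy]] := inv u.
    by apply: nb (old_ _ _ bu xw); rewrite adjC.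
  have : st_sent (conf r u) <= size K; last by lia.
  rewrite -(size_takel cKu); apply: uniq_leq_size; first exact: take_uniq.
  by apply: nb; rewrite adjC.
Qed.

Lemma conf_stepE p t r v : p < P -> vertex_inv p t r v ->
  let st := conf r v in
  let K' := learn (st_known st) (decode (inbox r v)) in
  let c' := minn (st_sent st).+1 (size (st_known st)) in
  conf r.+1 v =
  if t.+1 == T then
    let q' := pub_upd B (public p).1 (canon K') in
    FloodState (id v) (row v) q' p.+1 0 (learn K' (pub_sel B q' (id v) (row v))) c'
  else FloodState (id v) (row v) (public p).1 p t.+1 K' c'.
Proof.
move=> pP [[e1 e2 e3] _]; have [e4 e5 _] := @conf_static r v.
rewrite /= conf_step /flood_step; move: e1 e2 e3 e4 e5.
by case: (conf r v) => i rw q p' t' K c /= -> -> -> -> ->; rewrite leqNgt pP.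
Qed.

Lemma flood_inv_step p t r : p < P -> t.+1 < T -> flood_inv p t r -> flood_inv p t.+1 r.+1.
Proof.
move=> pP tT inv v /=.
have stepE u := conf_stepE pP (let: And3 vi _ _ := inv u in vi).
have [[uK' cK old own_ sub] nb greedy] := flood_round inv v.
have cc : st_sent (conf r.+1 v) = minn (st_sent (conf r v)).+1 (size (st_known (conf r v))).
  by rewrite stepE ltn_eqF.
rewrite /vertex_inv; split.
- rewrite stepE ltn_eqF //=; split=> //; split=> //.
    by rewrite size_cat (leq_trans cK) ?leq_addr.
  by rewrite take_learn.
- move=> u uv; rewrite !stepE ltn_eqF //= take_learn ?geq_minr //; exact: nb.
- move=> d; rewrite stepE ltn_eqF //= take_learn //; exact: greedy.
Qed.

(** At the end of a phase every fact has reached every vertex, so all canonical lists coincide with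
    the one in [public] and all vertices compute the same next state. *)
Lemma flood_inv_next p t r : p < P -> t.+1 = T -> flood_inv p t r -> flood_inv p.+1 0 r.+1.
Proof.
move=> pP tT inv.
have stepE u := conf_stepE pP (let: And3 vi _ _ := inv u in vi).
have all_sent u : let st := conf r u in
    {subset (public p.+1).2 <= take (st_sent st) (st_known st)}.
  have [vi nb greedy] := inv u => /= f; rewrite mem_publicS.
  case: (vi) => _ [uK cK oldK ownK Ksub] /orP[/oldK//|/freshP[w fw]].
  have [|] := greedy D; first by apply; [exact: hopD | exact: fw].
  (* A vertex busy since round [D] would have sent at least [T - 1 - D] facts beyond the old ones,
     more than the [#|U| * k] that can be fresh. *)
  move=> busy; have := uniq_leq_size uK Ksub; rewrite size_cat.
  have := size_fresh p; move: tT T_large cK busy; set M := #|U| * k.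
  move: (st_sent _) (size (st_known _)) (size (fresh p)) (size (public p).2).
  by move=> c K a b; move: D M; clear=> *; lia.
pose K' u := learn (st_known (conf r u)) (decode (inbox r u)).
have K'E u : K' u =i (public p.+1).2.
  have [[_ _ _ _ sub] _ _] := flood_round inv u.
  move=> f; apply/idP/idP.
    by move=> /sub; rewrite mem_publicS mem_cat.
  by move=> /all_sent/mem_take h; rewrite /K' mem_learn h.
have canonE u : canon (K' u) = (public p.+1).2.
  have [[uK' _ _ _ _] _ _] := flood_round inv u.
  rewrite publicS; apply: canon_eq; rewrite ?undup_uniq // => f.
  by rewrite K'E mem_publicS mem_undup mem_cat.
have stE u : conf r.+1 u =
    FloodState (id u) (row u) (public p.+1).1 p.+1 0
      (learn (K' u) (own (public p.+1).1 u))
      (minn (st_sent (conf r u)).+1 (size (st_known (conf r u)))).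
  have e1 : (public p.+1).1 = pub_upd B (public p).1 (public p.+1).2.
    by rewrite publicS.
  by rewrite stepE tT eqxx; cbv zeta; rewrite -/(K' u) canonE -e1.
move=> v.
have vi u : vertex_inv p.+1 0 r.+1 u.
  have [[uK' cK old own_ sub] nb greedy] := flood_round inv u.
  have cK' : minn (st_sent (conf r u)).+1 (size (st_known (conf r u))) <= size (K' u).
    by rewrite size_cat (leq_trans cK) ?leq_addr.
  rewrite /vertex_inv stE /=; split=> //; split.
  + exact: learn_uniq.
  + by rewrite size_cat (leq_trans cK') ?leq_addr.
  + move=> f /(all_sent u) h; rewrite take_learn // take_learn //.
    have cc : st_sent (conf r u) <= minn (st_sent (conf r u)).+1 (size (st_known (conf r u))).
      by rewrite leq_min leqnSn; have [[_ []]] := inv u.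
    exact: take_sub cc _ h.
  + by move=> f h; rewrite mem_learn h orbT.
  + move=> f; rewrite mem_learn K'E mem_cat => /orP[->//|h].
    by apply/orP; right; apply/freshP; exists u.
split=> [||d]; [exact: vi| |right; rewrite sub0n addn0; exact: size_old (vi v)].
move=> u uv f; rewrite !stE /= take_learn; last first.
  by rewrite size_cat (leq_trans (geq_minr _ _)) ?leq_addr.
by move=> /mem_take; rewrite [in X in _ -> X]mem_learn !K'E => ->.
Qed.

Lemma flood_inv_start : flood_inv 0 0 0.
Proof.
move=> v; split; last by right.
- split=> //; split=> //=; first exact: learn_uniq.
    by move=> f h; rewrite mem_learn h orbT.
  by move=> f; rewrite mem_learn => h; apply/freshP; exists v.
- by move=> u _ f; rewrite /= take0.
Qed.

Lemma flood_phases p : p <= P -> flood_inv p 0 (p * T).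
Proof.
elim: p => [_|p IH pP]; first exact: flood_inv_start.
have T0 : 0 < T by lia.
have within t : t < T -> flood_inv p t (p * T + t).
  elim: t => [_|t IHt tT]; first by rewrite addn0; apply: IH; lia.
  by rewrite addnS; apply: flood_inv_step => //; apply: IHt; lia.
have -> : p.+1 * T = (p * T + T.-1).+1 by rewrite mulSn; lia.
by apply: (flood_inv_next (t := T.-1)) => //; [lia | apply: within; lia].
Qed.

Lemma flood_output_public v :
  flood_output (conf (P * T) v) = Some (pub_out B (public P).1 (id v)).
Proof.
have [[[e1 e2 _] _] _ _] := flood_phases (leqnn P) v.
have [e3 _ _] := @conf_static (P * T) v.
by rewrite /flood_output e2 leqnn e1 e3.
Qed.

End Flooding.

Lemma flood_bandwidth (R : realType) B P T (V : finType) (id : V -> nat)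
    (G : wgraph V) (U : {set V}) (Gt : wgraph V) :
  respects_bandwidth (flood_alg R B P T) id G U Gt 3.
Proof.
move=> s r u v _; rewrite /= /flood_send.
case e: (onth _ _) => [[[a b] w]|] //=.
have [_ _ ok] := @conf_static R B P T V id G U Gt s r u.
have [x [y [z [xy [-> -> ->]]]]] := ok _ (onth_mem e).
have mid t : id t <= max_word id G Gt.
  by rewrite /max_word leq_max (leq_bigmax t).
rewrite /legal_message /= !mid /= andbT /max_word leq_max; apply/orP; right.
have := leq_bigmax (F := fun e : V * V => maxn (odflt 0 (G e.1 e.2)) (odflt 0 (Gt e.1 e.2))) (x, y).
by apply: leq_trans; rewrite /= xy leq_max leqnn orbT.
Qed.

(** * The hopset protocol *)

Section Levels.
Variable R : realType.
Variables (k h N top : nat) (prob target : nat -> R).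

(* The common state: all facts published so far, the hopset edges of the previous
   levels, the sources of the current level (initially all identities), its index
   and the number of its completed phases. *)
Record level := Level {
  lv_facts : seq fact;
  lv_edges : seq fact;
  lv_sources : pred nat;
  lv_index : nat;
  lv_round : nat }.

Definition level_sel (q : level) (v : nat) (row : seq (nat * nat)) : seq fact :=
  let X := lv_facts q ++ lv_edges q in
  [seq (v, e.1, e.2) | e <- projT1 (cid (selects_exists k row X (lv_sources q)))].

Definition good_sample (X : seq fact) (A : pred nat) (p : R) (S : seq nat) : Prop :=
  let n := size (members X A) in
  [/\ {subset S <= members X A}, ((size S)%:R <= 3 * p * n%:R)%R,
      ((\sum_(c <- members X A) find (mem S) (by_dst X A c))%:R <= 3 * n%:R / p)%R &
      forall c, c \in members X A -> k <= size (by_dst X A c) ->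
        has (mem S) (take k (by_dst X A c))].

(** [xget] is applied to public data, so all vertices agree on the sample without communication. At
    the last level the empty set makes each bunch the whole list. *)
Definition next_sources (i : nat) (X : seq fact) (A : pred nat) : pred nat :=
  if i == top then pred0 else mem (xget [::] [set S | good_sample X A (prob i) S]).

Definition level_upd (q : level) (F : seq fact) : level :=
  if (lv_round q).+1 == h then
    let X := F ++ lv_edges q in
    let A' := next_sources (lv_index q) X (lv_sources q) in
    Level F (lv_edges q ++ bunch_edges X (lv_sources q) A') A' (lv_index q).+1 0
  else Level F (lv_edges q) (lv_sources q) (lv_index q) (lv_round q).+1.

(** Several levels may join the same pair with different weights. *)
Definition lightest (H : seq fact) (a b : nat) : option nat :=
  if pselect (exists w, linked H a b w) is left ex then Some (ex_minn ex) else None.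

Definition level_out (q : level) (v : nat) : seq (nat * nat) :=
  sort (fun a b => a.1 <= b.1)
    (pmap (fun u => omap (pair u) (lightest (lv_edges q) v u)) (verts (lv_edges q))).

Lemma level_sel_own q v row :
  {subset level_sel q v row <= [seq (v, e.1, e.2) | e <- row]}.
Proof.
rewrite /level_sel; case: cid => S /= [Srow _ _] f /mapP[e /Srow er ->].
exact: (map_f (fun e => (v, e.1, e.2))).
Qed.

Lemma size_level_sel q v row : size (level_sel q v row) <= k.
Proof. by rewrite /level_sel size_map; case: cid => S /= [_ ? _]. Qed.

Definition hopset_pub : publication :=
  @Publication level (Level [::] [::] predT 0 0) level_sel level_upd level_out
    level_sel_own.

(* The parameters of [close_or_near] at level [i]. At level 0 every vertex is a
   source, hence [near_factor 0 = 0] and blocks of a single jump suffice. *)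
Definition stop_count i := if i is 0 then 1 else N.
Definition near_factor i := if i is 0 then 0 else 2.
Fixpoint stretch i := if i is i'.+1 then stretch i' + 2 * near_factor i' else N.
Fixpoint hops i :=
  if i is i'.+1 then (2 * chain_hops (hops i') (stop_count i')).+1 else 0.

Hypotheses (k_gt1 : 1 < k) (N_gt0 : 0 < N) (N_large : 4 * top <= N) (h_gt0 : 0 < h).
Hypothesis h_large : forall i, i <= top -> chain_hops (hops i) (stop_count i) <= h.

Lemma stretchS i : stretch i.+1 = N + 4 * i.
Proof. by elim: i => [|i IH]; [rewrite /= !muln0 | rewrite [LHS]/= -/(stretch i.+1) IH /=; lia]. Qed.

Lemma stretch_ge i : N <= stretch i.
Proof. by case: i => [|i]; rewrite ?stretchS //; lia. Qed.

Variables (V : finType) (id : V -> nat) (U : {set V}) (Gt : wgraph V).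
Hypothesis id_inj : injective id.
Hypothesis Gt_on : graph_on U Gt.
Local Open Scope ring_scope.
(** [target i] will bound the number of sources of level [i], sampled further with probability
    [prob i]; the factor 3 comes from [hitting_set]. At level [top] fewer than [k] sources remain,
    so that no list is long. *)
Hypothesis prob01 : forall i, 0 < prob i <= 1.
Hypothesis prob_k : forall i, (i < top)%N -> 4 * #|U|%:R * (1 - prob i) ^+ k < 1.
Hypothesis targetS : forall i, (i < top)%N -> 3 * prob i * target i <= target i.+1.
Hypothesis target0 : #|U|%:R <= target 0.
Hypothesis target_top : target top < k%:R.
Local Close Scope ring_scope.

Let row v := table id (Gt v).
Let pub p := public hopset_pub id Gt p.

Definition host_facts : seq fact :=
  [seq (id e.1, id e.2, odflt 0 (Gt e.1 e.2)) | e <- enum {: V * V} & adj Gt e.1 e.2].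

Definition host_ids : seq nat := [seq id v | v <- enum U].

Lemma host_factsP f : f \in host_facts <-> sub_fact id Gt f.
Proof.
split.
  move=> /mapP[[x y]]; rewrite mem_filter /adj /= => /andP[+ _] ->.
  by case e: (Gt x y) => [w|] // _; exists x, y, w.
move=> [x [y [w [e ->]]]]; apply/mapP; exists (x, y); last by rewrite /= e.
by rewrite mem_filter /adj /= e mem_enum.
Qed.

Lemma linked_host a b w : linked host_facts a b w <->
  exists x y, [/\ Gt x y = Some w, a = id x & b = id y].
Proof.
split=> [/orP[] /host_factsP[x [y [z [e [-> -> ->]]]]] | [x [y [e -> ->]]]].
- by exists x, y.
- by exists y, x; rewrite wt_sym.
- by apply/orP; left; apply/host_factsP; exists x, y, w.
Qed.

Lemma linked_host_ids a b w : linked host_facts a b w ->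
  (a \in host_ids) && (b \in host_ids).
Proof.
move=> /linked_host[x [y [e -> ->]]].
have /andP[xU yU] : (x \in U) && (y \in U) by apply: Gt_on; rewrite /adj e.
by rewrite !map_f // mem_enum.
Qed.

Lemma size_host_ids : size host_ids = #|U|.
Proof. by rewrite size_map -cardE. Qed.

Lemma host_ids_uniq : uniq host_ids.
Proof. by rewrite map_inj_uniq ?enum_uniq. Qed.

Definition sound_edges (H : seq fact) := forall a b w, (a, b, w) \in H ->
  [/\ conn host_facts a b w, a != b, a \in host_ids & b \in host_ids].

Lemma sound_verts F H : {subset F <= host_facts} -> sound_edges H ->
  {subset verts (F ++ H) <= host_ids}.
Proof.
move=> Fh Hs x; rewrite mem_undup => /flattenP[s /mapP[[[a b] w] + ->]].
rewrite mem_cat => /orP[/Fh abw|/Hs[_ _ aU bU]]; last first.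
  by rewrite !inE => /orP[]/eqP->.
have /linked_host_ids/andP[aU bU] : linked host_facts a b w by rewrite /linked abw.
by rewrite !inE => /orP[]/eqP->.
Qed.

Lemma sound_conn F H a b l : {subset F <= host_facts} -> sound_edges H ->
  conn (F ++ H) a b l -> conn host_facts a b l.
Proof.
move=> Fh Hs; apply: conn_simulate => {a b l} a b w.
rewrite linked_cat => /orP[/(linked_sub Fh)/conn_edge //|].
by case/orP => /Hs[] // /conn_sym.
Qed.

Lemma size_members F H A : {subset F <= host_facts} -> sound_edges H ->
  size (members (F ++ H) A) <= count A host_ids.
Proof.
move=> Fh Hs; rewrite -size_filter; apply: uniq_leq_size.
  by rewrite filter_uniq // undup_uniq.
by move=> x; rewrite !mem_filter => /andP[-> /(sound_verts Fh Hs)->].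
Qed.

(** Each level has at most one edge per source for the pivots, plus the sum of the values of [find],
    which [hitting_set] bounds. *)
Definition edge_bound i : R := (\sum_(j < i) (target j + 3 * target j / prob j))%R.

Definition level_inv i (q : level) :=
  [/\ lv_index q = i, lv_round q = 0, sound_edges (lv_edges q) &
      close_or_near host_facts (host_facts ++ lv_edges q) (lv_sources q)
        (hops i) (near_factor i) (stretch i) N] /\
  [/\ ((count (lv_sources q) host_ids)%:R <= target i)%R &
      ((size (lv_edges q))%:R <= edge_bound i)%R].

Lemma level_inv_start : level_inv 0 (pub 0).1.
Proof.
split; split=> //=.
- move=> j x y len w; right; exists x => //; rewrite mul0n; exact: reach_refl.
- by rewrite count_predT size_host_ids.
- by rewrite /edge_bound big_ord0.
Qed.

Lemma pub_facts p : lv_facts (pub p).1 = (pub p).2.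
Proof. by case: p => [//|p]; rewrite /pub publicS /= /level_upd; case: ifP. Qed.

Lemma pub_level p : (pub p.+1).1 = level_upd (pub p).1 (pub p.+1).2.
Proof. by rewrite /pub publicS. Qed.

Lemma pub_sub p : {subset (pub p).2 <= host_facts}.
Proof.
elim: p => [//|p IH] f; rewrite mem_publicS => /orP[/IH//|/freshP[v]].
by move=> /sel_sub_fact /host_factsP.
Qed.

Lemma pub_mono p : {subset (pub p).2 <= (pub p.+1).2}.
Proof. by move=> f fp; rewrite mem_publicS fp. Qed.

Lemma level_rounds i p r : level_inv i (pub p).1 -> r < h ->
  (pub (p + r)).1 = Level (pub (p + r)).2 (lv_edges (pub p).1) (lv_sources (pub p).1) i r.
Proof.
move=> [[ei er _ _] _]; elim: r => [|r IH] rh.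
  by rewrite addn0 -pub_facts; case: (pub p).1 ei er => /= ? ? ? ? ? -> ->.
by rewrite addnS pub_level IH 1?ltnW // /level_upd /= ltn_eqF.
Qed.

Lemma level_sel_facts i p r v : level_inv i (pub p).1 -> r < h ->
  exists row S,
  [/\ forall u w, linked host_facts v u w -> (u, w) \in row,
      forall e, e \in S -> linked (pub (p + r.+1)).2 v e.1 e.2 &
      selects k row S ((pub (p + r)).2 ++ lv_edges (pub p).1) (lv_sources (pub p).1)].
Proof.
move=> inv rh; have [[x vx]|nx] := pselect (exists x, v = id x); last first.
  exists [::], [::]; split=> //.
    by move=> u w /linked_host[x [y [_ vx _]]]; case: nx; exists x.
  by move=> l; left.
have e := level_rounds inv rh.
pose S := projT1 (cid (selects_exists k (row x)
  ((pub (p + r)).2 ++ lv_edges (pub p).1) (lv_sources (pub p).1))).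
have [Srow Sk sel] := projT2 (cid (selects_exists k (row x)
  ((pub (p + r)).2 ++ lv_edges (pub p).1) (lv_sources (pub p).1))).
exists (row x), S; split=> //.
  move=> u w /linked_host[x' [y [xy ex ->]]]; apply/mem_table; exists y => //=.
  by rewrite -xy; congr (Gt _ y); apply: id_inj; rewrite -ex -vx.
move=> e' Se'; rewrite /linked addnS mem_publicS; apply/orP; left; apply/orP; right.
apply/freshP; exists x; rewrite /own -/(pub (p + r)) -/(row x) /= /level_sel e vx.
exact: (map_f (fun e => (id x, e.1, e.2))).
Qed.

Lemma level_found i p c e l :
  level_inv i (pub p).1 -> i <= top ->
  let H := lv_edges (pub p).1 in let A := lv_sources (pub p).1 in
  chain (host_facts ++ H) A (hops i) (stop_count i) c e l ->
  found ((pub (p + h)).2 ++ H) A k c e l.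
Proof.
move=> inv it H A; pose F r := (pub (p + r)).2.
rewrite -/(F h); apply: found_chain; last exact: h_large.
- by move=> r _; rewrite /F addnS; exact: pub_mono.
- by move=> r v rh; exact: level_sel_facts inv rh.
Qed.

Lemma edges_bunch_sound X F H A A' : X = F ++ H -> {subset F <= host_facts} ->
  sound_edges H -> sound_edges (bunch_edges X A A').
Proof.
move=> -> Fh Hs a b w /bunch_edgesP[am bm ab _ /(sound_conn Fh Hs) cab].
split=> //; apply: (sound_verts Fh Hs).
  by move: am; rewrite mem_filter => /andP[].
by move: bm; rewrite mem_filter => /andP[].
Qed.

Lemma next_sourcesP i X A : i < top ->
  size (members X A) <= #|U| ->
  exists2 S, next_sources i X A = mem S & good_sample X A (prob i) S.
Proof.
move=> it mU; rewrite /next_sources ltn_eqF //; eexists; first by [].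
apply: xgetPex; apply: hitting_set.
- by rewrite filter_uniq // undup_uniq.
- move=> c _; split; first exact: by_dst_uniq.
  by move=> z; rewrite mem_by_dst mem_filter => /and3P[_ -> ->].
- exact: prob01.
- apply: le_lt_trans (prob_k it); have /andP[p0 p1] := prob01 i.
  apply: ler_wpM2r; first by rewrite exprn_ge0 // subr_ge0.
  by apply: ler_wpM2l => //; rewrite ler_nat.
Qed.

Lemma near_factorE i : N * near_factor i <= stop_count i * near_factor i.
Proof. by case: i => //=; lia. Qed.

Lemma level_end i p (inv : level_inv i (pub p).1) : 
  let H := lv_edges (pub p).1 in let A := lv_sources (pub p).1 in
  let X := (pub (p + h)).2 ++ H in let A' := next_sources i X A in
  (pub (p + h)).1 = Level (pub (p + h)).2 (H ++ bunch_edges X A A') A' i.+1 0.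
Proof.
have hE : p + h = (p + h.-1).+1 by lia.
by rewrite hE pub_level (level_rounds inv) ?prednK // /level_upd /= prednK // eqxx.
Qed.

(** Leaving [A'] arbitrary covers both the sampled levels and the last one, where [pred0] hits the
    long lists vacuously. *)
Lemma level_close i p : level_inv i (pub p).1 -> i <= top ->
  let H := lv_edges (pub p).1 in let A := lv_sources (pub p).1 in
  let X := (pub (p + h)).2 ++ H in
  forall A' : pred nat, (forall c, c \in members X A -> k <= size (by_dst X A c) ->
    has A' (take k (by_dst X A c))) ->
  close_or_near host_facts (host_facts ++ (H ++ bunch_edges X A A')) A'
    (hops i.+1) 2 (stretch i.+1) N.
Proof.
move=> inv it H A X A' hits; have [[_ _ _ con] _] := inv.
apply: (level_step N_gt0 (stretch_ge i) _ (near_factorE i) _ con k_gt1 hits).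
- by case: i {inv it con}.
- by rewrite -/(stretch i.+1) stretchS; lia.
- by move=> c e l _ _; exact: level_found inv it.
Qed.

Lemma level_invS i p : level_inv i (pub p).1 -> i < top ->
  level_inv i.+1 (pub (p + h)).1.
Proof.
move=> inv it; rewrite (level_end inv); have close := level_close inv (ltnW it).
have [[_ _ Hs _] [cA sH]] := inv.
set H := lv_edges _ in close Hs sH *; set A := lv_sources _ in close cA *.
have Fh := @pub_sub (p + h); set X := _ ++ H in close *.
have nX : size (members X A) <= count A host_ids by exact: size_members.
have [|S nextE [SX szS sumS hits]] := @next_sourcesP i X A it.
  by apply: leq_trans nX _; rewrite -size_host_ids count_size.
rewrite nextE; split.
  split=> //; last exact: close.
  move=> a b w; rewrite mem_cat => /orP[/Hs //|].
  exact: (edges_bunch_sound (erefl X) Fh Hs).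
have /andP[p0 p1] := prob01 i.
have nt : ((size (members X A))%:R <= target i)%R.
  by apply: le_trans cA; rewrite ler_nat.
split=> /=.
  apply: le_trans (targetS it).
  apply: (@le_trans _ _ (size S)%:R%R).
    rewrite ler_nat -size_filter; apply: uniq_leq_size.
      by rewrite filter_uniq // host_ids_uniq.
    by move=> z; rewrite mem_filter => /andP[].
  apply: le_trans szS _; apply: ler_wpM2l nt; by rewrite mulr_ge0 // ltW.
rewrite /edge_bound big_ord_recr /= size_cat natrD; apply: lerD => //.
apply: (@le_trans _ _ ((size (members X A))%:R +
    3 * (size (members X A))%:R / prob i)%R).
  apply: le_trans (lerD (lexx _) sumS); rewrite -natrD ler_nat.
  exact: size_bunch_edgesD.
by apply: lerD => //; rewrite ler_pM2r ?invr_gt0 // ler_pM2l.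
Qed.

Lemma level_inv_all i : i <= top -> level_inv i (pub (i * h)).1.
Proof.
elim: i => [_|i IH it]; first exact: level_inv_start.
by rewrite mulSn addnC; apply: level_invS => //; apply: IH; exact: ltnW.
Qed.

Definition final_edges := lv_edges (pub (top.+1 * h)).1.

(** After the last level [A'] is empty, so the second alternative of [close_or_near] is impossible
    and every walk is covered. Its bunches may join all pairs of sources, which accounts for the
    quadratic term. *)
Lemma final_edges_spec :
  [/\ sound_edges final_edges,
      ((size final_edges)%:R <= edge_bound top + target top * (target top + 1))%R &
      forall j x y len, walk host_facts j x y len ->
        exists2 l, reach (host_facts ++ final_edges) (hops top.+1) x y l &
                   N * l <= (N + 4 * top) * len].
Proof.
have inv := level_inv_all (leqnn top); have close := level_close inv (leqnn top).
rewrite /final_edges mulSn addnC (level_end inv) /=.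
rewrite {1 2 3}/next_sources eqxx.
have [[_ _ Hs _] [cA sH]] := inv.
set H := lv_edges _ in close Hs sH *; set A := lv_sources _ in close cA *.
have Fh := @pub_sub (top * h + h); set X := _ ++ H in close *.
have nX : size (members X A) <= count A host_ids by exact: size_members.
have nt : ((size (members X A))%:R <= target top)%R.
  by apply: le_trans cA; rewrite ler_nat.
have short c : size (by_dst X A c) < k.
  apply: leq_ltn_trans (size_by_dst _ _ _) _; rewrite -(ltr_nat R).
  exact: le_lt_trans nt target_top.
split.
- move=> a b w; rewrite mem_cat => /orP[/Hs //|].
  exact: (edges_bunch_sound (erefl X) Fh Hs).
- rewrite size_cat natrD; apply: lerD => //.
  apply: (@le_trans _ _ ((size (members X A) * (size (members X A)).+1)%:R)%R).
    rewrite ler_nat; apply: leq_trans (size_bunch_edgesD _ _ _) _.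
    rewrite mulnS leq_add2l -[X in _ <= _ * X]sum1_size big_distrr /=.
    apply: leq_sum => c _; rewrite muln1.
    exact: leq_trans (find_size _ _) (size_by_dst _ _ _).
  rewrite natrM -[X in (_ * X)%R]natr1; apply: ler_pM => //.
  by rewrite lerD2r.
- move=> j x y len w; rewrite -stretchS; case: (close pred0 _ _ _ _ _ w) => //.
    by move=> c _; rewrite leqNgt short.
  by case.
Qed.

End Levels.

(** * From lists of edges to weighted graphs *)

Lemma lightestP H a b w : linked H a b w ->
  exists w', [/\ lightest H a b = Some w', linked H a b w' & w' <= w].
Proof.
rewrite /lightest => ab; case: pselect => [ex|[]]; last by exists w.
by exists (ex_minn ex); case: ex_minnP => w' h hmin; split=> //; exact: hmin.
Qed.

Lemma lightest_linked H a b w : lightest H a b = Some w -> linked H a b w.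
Proof. by rewrite /lightest; case: pselect => // ex [<-]; case: ex_minnP. Qed.

Lemma lightest_sym H a b : lightest H a b = lightest H b a.
Proof.
case e1: (lightest H a b) => [w|]; case e2: (lightest H b a) => [w'|] //.
- have := lightest_linked e1; rewrite linked_sym => /lightestP[v [+ _ vw]].
  have := lightest_linked e2; rewrite linked_sym => /lightestP[v' [+ _ vw']].
  by rewrite e1 e2 => -[ev] [ev']; congr Some; lia.
- by have := lightest_linked e1; rewrite linked_sym => /lightestP[v []]; rewrite e2.
- by have := lightest_linked e2; rewrite linked_sym => /lightestP[v []]; rewrite e1.
Qed.

(** Reconciles the output, built from the list of edges, with the table of the graph, built from the
    enumeration of the vertices. *)
Lemma sorted_by_key_eq (s1 s2 : seq (nat * nat)) :
  uniq [seq e.1 | e <- s1] -> uniq [seq e.1 | e <- s2] -> s1 =i s2 ->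
  sort (fun a b => a.1 <= b.1) s1 = sort (fun a b => a.1 <= b.1) s2.
Proof.
move=> u1 u2 e12.
have srt s : uniq [seq e.1 | e <- s] ->
    sorted (relpre fst ltn) (sort (fun a b : nat * nat => a.1 <= b.1) s).
  move=> us; rewrite -sorted_map ltn_sorted_uniq_leq.
  rewrite (perm_uniq (perm_map fst (permEl (perm_sort _ s)))) us sorted_map.
  by apply: sort_sorted => x y; exact: leq_total.
apply: (irr_sorted_eq (leT := relpre fst ltn)).
- by move=> y x z; exact: ltn_trans.
- by move=> x; exact: ltnn.
- exact: srt.
- exact: srt.
- by move=> x; rewrite !mem_sort.
Qed.

Section EdgeLists.
Variables (V : finType) (id : V -> nat) (U : {set V}) (Gt : wgraph V).
Hypothesis id_inj : injective id.
Hypothesis Gt_on : graph_on U Gt.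
Variable E : seq fact.
Hypothesis E_sound : sound_edges id U Gt E.

Let HF := host_facts id Gt.

Lemma host_walk_pos j a b l : walk HF j a b l -> a != b -> 0 < l.
Proof.
case=> [c|{}j c d e w q /linked_host[x [y [/wt_pos xy _ _]]] _ _]; last by lia.
by rewrite eqxx.
Qed.

Definition list_wt u v := lightest E (id u) (id v).

Lemma list_wt_sym u v : list_wt u v = list_wt v u.
Proof. exact: lightest_sym. Qed.

Lemma sound_linked a b w : linked E a b w ->
  [/\ conn HF a b w, a != b, a \in host_ids id U & b \in host_ids id U].
Proof.
case/orP => /E_sound[c n aU bU] //.
by split=> //; [exact: conn_sym | rewrite eq_sym].
Qed.

Lemma list_wt_irr v : list_wt v v = None.
Proof.
case e: (list_wt v v) => [w|] //.
by have [_] := sound_linked (lightest_linked e); rewrite eqxx.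
Qed.

Lemma list_wt_pos u v w : list_wt u v = Some w -> 0 < w.
Proof.
move=> /lightest_linked/sound_linked[[b [j [l [_ lw wk]]]] uv _ _].
exact: leq_trans (host_walk_pos wk uv) lw.
Qed.

Definition list_graph : wgraph V := WGraph list_wt_sym list_wt_irr list_wt_pos.

Lemma mem_host_ids u : (id u \in host_ids id U) = (u \in U).
Proof. by rewrite mem_map // mem_enum. Qed.

Lemma list_graph_on : graph_on U list_graph.
Proof.
move=> u v; rewrite /adj /=; case e: (list_wt u v) => [w|] // _.
by have [_ _] := sound_linked (lightest_linked e); rewrite !mem_host_ids => -> ->.
Qed.

Lemma table_list_graph v : table id (list_graph v) =
  sort (fun a b => a.1 <= b.1)
    (pmap (fun u => omap (pair u) (lightest E (id v) u)) (verts E)).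
Proof.
have keys (T : eqType) (f : T -> nat) (g : T -> option nat) s : injective f -> uniq s ->
    uniq [seq e.1 | e <- pmap (fun u => omap (pair (f u)) (g u)) s].
  move=> fi; elim: s => //= x s IH /andP[xs /IH us]; case: (g x) => //= y.
  rewrite us andbT; apply/negP => /mapP[e]; rewrite mem_pmap => /mapP[z zs].
  by case: (g z) => //= t [->] /= /fi xz; rewrite xz zs in xs.
apply: sorted_by_key_eq.
- by apply: keys; rewrite ?enum_uniq.
- by apply: (keys nat (fun x => x) (lightest E (id v))); rewrite ?undup_uniq.
move=> e; rewrite !mem_pmap; apply/mapP/mapP => -[x _].
  rewrite /= /list_wt; case el: (lightest _ _ _) => [w|] //= [->].
  exists (id x); last by rewrite el.
  by have /andP[] := linked_verts (lightest_linked el).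
case el: (lightest _ _ _) => [w|] //= [->].
have [_ _ _ /mapP[y _ xy]] := sound_linked (lightest_linked el).
by exists y; rewrite ?mem_enum //= /list_wt -xy el.
Qed.

Lemma card_edges_list : #|edges list_graph| <= size E.
Proof.
rewrite -(size_map (fun e : fact => [set x | (id x == e.1.1) || (id x == e.1.2)]%SET)).
apply: leq_trans (card_size _); apply/subset_leq_card/fintype.subsetP => S.
case/imsetP => -[u v]; rewrite inE /adj /=; case e: (list_wt u v) => [w|] // _ ->.
have [uv|vu] := orP (lightest_linked e); apply/mapP.
  by exists (id u, id v, w) => //; apply/setP => x; rewrite !inE /= !(inj_eq id_inj).
exists (id v, id u, w) => //; apply/setP => x; rewrite !inE /= !(inj_eq id_inj).
by rewrite orbC.
Qed.

Lemma path_walk u v p : is_path Gt u v p ->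
  walk HF (size p) (id u) (id v) (path_length Gt u p).
Proof.
case; elim: p u => [|x p IH] u /=; first by move=> _ ->; exact: walk0.
case/andP => ux px lx; apply: walkS (IH _ px lx).
move: ux; rewrite /adj; case e: (Gt u x) => [w|] // _.
by apply/linked_host; exists u, x.
Qed.

Lemma walk_path j a b l : walk HF j a b l -> forall u v, a = id u -> b = id v ->
  exists2 p, is_path Gt u v p & path_length Gt u p = l.
Proof.
elim=> [c u v -> /id_inj <-|{}j c d e w q cd _ IH u v cu ev]; first by exists [::].
have /linked_host[x [y [xy cx dy]]] := cd.
have [p [px lx] pl] := IH y v dy ev.
have <- : x = u by apply: id_inj; rewrite -cx.
exists (y :: p); last by rewrite /= xy pl.
by split=> //=; rewrite px andbT /adj xy.
Qed.

Let GU := gunion Gt list_graph.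

Lemma union_linked a b w : linked (HF ++ E) a b w ->
  exists u v w', [/\ a = id u, b = id v, GU u v = Some w' & w' <= w].
Proof.
rewrite linked_cat => /orP[/linked_host[x [y [xy -> ->]]]|ab].
  exists x, y; rewrite /GU /= /union_wt xy; case: (list_graph x y) => [z|].
    by exists (minn w z); split=> //; exact: geq_minl.
  by exists w.
have [_ _ /mapP[x _ ax] /mapP[y _ by_]] := sound_linked ab.
have [w' [e _ ww]] := lightestP ab; exists x, y; rewrite /GU /= /union_wt.
have -> : list_graph x y = Some w' by rewrite /= /list_wt -ax -by_.
case: (Gt x y) => [z|]; last by exists w'.
by exists (minn z w'); split=> //; apply: leq_trans (geq_minr _ _) ww.
Qed.

Lemma walk_union j a b l : walk (HF ++ E) j a b l -> forall u v, a = id u -> b = id v ->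
  exists p, [/\ is_path GU u v p, size p = j & path_length GU u p <= l].
Proof.
elim=> [c u v -> /id_inj <-|{}j c d e w q cd _ IH u v cu ev]; first by exists [::].
have [x [y [w' [cx dy xy ww]]]] := union_linked cd.
have [p [[px lx] sp pl]] := IH y v dy ev.
have <- : x = u by apply: id_inj; rewrite -cx.
exists (y :: p); split=> /=; last 1 first.
- by rewrite [union_wt _ _ _ _]xy /= leq_add.
- by split=> //=; rewrite px andbT /adj xy.
- by rewrite sp.
Qed.

Lemma union_conn u v p : is_path GU u v p -> conn HF (id u) (id v) (path_length GU u p).
Proof.
case; elim: p u => [|x p IH] u /=; first by move=> _ ->; exact: conn_refl.
case/andP => ux px lx; apply: conn_trans (IH _ px lx).
move: ux; rewrite /adj /GU /= /union_wt.
have gt w : Gt u x = Some w -> conn HF (id u) (id x) w.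
  by move=> e; apply/conn_edge/linked_host; exists u, x.
have ht w : list_wt u x = Some w -> conn HF (id u) (id x) w.
  by move=> /lightest_linked/sound_linked[].
case e1: (Gt u x) => [w1|]; case e2: (list_graph u x) => [w2|] //= _; auto.
by rewrite /minn; case: ifP => _; auto.
Qed.

(** The lower bound replaces hopset edges by host walks; the upper bound turns a host path into a
    walk, applies the hop bound and returns to a path of the union. *)
Lemma list_hopset (R : realType) (b : nat) (eps : R) (N M : nat) :
  0 < N -> (0 < eps)%R -> (M%:R <= (1 + eps) * N%:R)%R ->
  (forall j x y len, walk HF j x y len ->
     exists2 l, reach (HF ++ E) b x y l & N * l <= M * len) ->
  hopset b eps U Gt list_graph.
Proof.
move=> N0 e0 MN hop; split; first exact: list_graph_on.
move=> u v _ _; split.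
  apply: le_ereal_inf_tmp => _ [p [pp _] <-].
  have [c [j [l [_ lp w]]]] := union_conn pp.
  have [p' pp' pl] := walk_path w (erefl _) (erefl _).
  apply: (@le_trans _ _ (path_length Gt u p')%:R%:E).
    by apply: ereal_inf_lbound; exists p'.
  by rewrite lee_fin ler_nat pl.
have e1 : (0 < 1 + eps)%R by rewrite addr_gt0.
rewrite -lee_pdivrMl //; apply: le_ereal_inf_tmp => _ [p pp <-].
rewrite lee_pdivrMl //.
have [l [j [l' [jb ll w]]] h] := hop _ _ _ _ (path_walk pp).
have [p' [pp' sp pl]] := walk_union w (erefl _) (erefl _).
apply: (@le_trans _ _ (path_length GU u p')%:R%:E).
  by apply: ereal_inf_lbound; exists p' => //; split=> //; rewrite sp.
rewrite -EFinM lee_fin -(ler_pM2l (_ : 0 < N%:R :> R)%R) ?ltr0n //.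
apply: (@le_trans _ _ (M%:R * (path_length Gt u p)%:R)%R).
  rewrite -!natrM ler_nat; apply: leq_trans h; apply: leq_mul => //.
  exact: leq_trans ll.
by rewrite mulrCA mulrA; apply: ler_wpM2r.
Qed.

End EdgeLists.

Lemma hop_diameter_ball (R : realType) (V : finType) (G : wgraph V) (D : nat) :
  hop_diameter R G = D%:R%:E -> forall u w, ball G D u w.
Proof.
move=> hD u w.
have ball_le d d' x y : d <= d' -> ball G d x y -> ball G d' x y.
  elim: d d' x => [|d IH] [|d'] x //=; first by move=> _; left.
  by move=> dd [|[z xz /(IH _ _ dd)]]; [left | right; exists z].
(* A strict inequality on the infimum yields an actual path, and fewer than [D.+1] edges means at
   most [D]. *)
have : (min_hops R G u w < D.+1%:R%:E)%E.
  apply: (@le_lt_trans _ _ D%:R%:E); last by rewrite lte_fin ltr_nat.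
  by rewrite -hD; apply: ereal_sup_ubound; exists (u, w).
move=> /ereal_inf_lt[_ [p [pp lp] <-]]; rewrite lte_fin ltr_nat ltnS => /ball_le; apply.
elim: p u pp lp => [|x p IH] u /=; first by [].
by case/andP => ux px lx; right; exists x => //; exact: IH.
Qed.

(** * Choice of the parameters *)

Section Numerics.
Variable R : realType.
Local Open Scope ring_scope.
Implicit Types x y : R.

Lemma ln2_bounds : 1 / 2 <= ln (2 : R) <= 1.
Proof.
apply/andP; split; last by have := @le_ln1Dx R 1; rewrite -natr1; apply; lra.
rewrite -[X in X <= _]expRK ler_ln ?posrE ?expR_gt0 //.
have := expR_ge1Dx (- (1 / 2) : R); rewrite expRN => h.
rewrite -[expR _]invrK -[leRHS]invrK lef_pV2 ?posrE ?invr_gt0 ?expR_gt0 //; lra.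
Qed.

Lemma powR2_log2 x : 0 < x -> 2 `^ (log2 x) = x.
Proof.
move=> x0; have /andP[l1 _] := ln2_bounds.
by rewrite /powR gt_eqF // /log2 divfK ?gt_eqF ?lnK ?posrE //; lra.
Qed.

Lemma powR_log2 x y : 0 < x -> x `^ y = 2 `^ (y * log2 x).
Proof. by move=> x0; rewrite mulrC powRrM powR2_log2. Qed.

Lemma powR2D x y : 2 `^ (x + y) = 2 `^ x * 2 `^ y :> R.
Proof. by rewrite powRD // pnatr_eq0 implybT. Qed.

Lemma powR2_le x y : x <= y -> 2 `^ x <= 2 `^ y :> R.
Proof. by move=> xy; apply: ler_powR => //; lra. Qed.

Lemma powR2_ge x : 0 <= x -> x <= 2 `^ x.
Proof.
move=> x0; have /andP[l1 _] := ln2_bounds.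
rewrite /powR gt_eqF //.
have h : 1 + x / 4 <= expR (x * ln 2 / 2).
  have ? : 0 <= x * (ln 2 - 1 / 2) by rewrite mulr_ge0 //; lra.
  by apply: le_trans (expR_ge1Dx _); lra.
have -> : x * ln 2 = x * ln 2 / 2 + x * ln 2 / 2 by field.
rewrite expRD; apply: (@le_trans _ _ ((1 + x / 4) * (1 + x / 4))).
  by have := sqr_ge0 (x / 4 - 1); rewrite expr2; lra.
by apply: ler_pM => //; lra.
Qed.

Lemma powR2_ge1 x : 0 <= x -> 1 <= 2 `^ x.
Proof. by move=> /powR2_le; rewrite powRr0. Qed.

Lemma log2_mono x y : 0 < x -> x <= y -> log2 x <= log2 y.
Proof.
move=> x0 xy; have /andP[l1 _] := ln2_bounds.
rewrite /log2 ler_pM2r ?invr_gt0; last by lra.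
by rewrite ler_ln ?posrE //; lra.
Qed.

Lemma log2X n : log2 (2 ^+ n : R) = n%:R.
Proof.
have /andP[l1 _] := ln2_bounds.
by rewrite /log2 lnXn ?posrE // -[ln 2 *+ n]mulr_natl mulfK // gt_eqF //; lra.
Qed.

Lemma log2M x y : 0 < x -> 0 < y -> log2 (x * y) = log2 x + log2 y.
Proof. by move=> x0 y0; rewrite /log2 lnM ?posrE // mulrDl. Qed.

Lemma pow2_between y : 1 <= y -> exists j : nat, 2 ^+ j <= y < 2 ^+ j.+1.
Proof.
move=> y1.
have ex : exists j : nat, y < 2 ^+ j.
  exists (Num.trunc y).+1; apply: lt_le_trans (truncnS_gt y) _.
  by rewrite -natrX ler_nat ltnW // ltn_expl.
case: (ex_minnP ex) => -[|j] yj jmin; first by rewrite expr0 in yj; lra.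
by exists j; rewrite yj andbT leNgt; apply/negP => /jmin; rewrite ltnn.
Qed.

Section Exponents.
(* [lam], [rr] and [lm] are the binary logarithms of m^(1/kappa), m^rho, m. *)
Variables lam rr lm : R.
Hypothesis lam4 : 4 <= lam.
Hypothesis lam_rr : lam <= rr.

Definition step i : R := Num.min rr (2 ^+ i * (lam - 1) + 1).
Definition depth i : R := \sum_(t < i) step t.

Lemma step_ge1 i : 1 <= step i.
Proof.
have l4 := lam4; have lr := lam_rr.
rewrite le_min; apply/andP; split; first lra.
by rewrite lerDr mulr_ge0 ?exprn_ge0 //; lra.
Qed.

Lemma step_le i : step i <= rr.
Proof. by rewrite ge_min lexx. Qed.

Lemma stepS i : step i.+1 <= 2 * step i - 1.
Proof.
have l4 := lam4; have lr := lam_rr.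
case: (leP rr (2 ^+ i * (lam - 1) + 1)) => h.
  have -> : step i = rr by rewrite /step (min_idPl h).
  by have := step_le i.+1; lra.
have -> : step i = 2 ^+ i * (lam - 1) + 1 by rewrite /step (min_idPr (ltW h)).
by rewrite ge_min exprS; apply/orP; right; lra.
Qed.

Lemma depthS i : depth i.+1 = depth i + step i.
Proof. by rewrite /depth big_ord_recr. Qed.

(** The logarithm of the number of edges of level [i] is about [lm + step i - depth i]. The term
    [i], gained by the [- 1] of the recurrence, makes the sum over levels geometric. *)
Lemma step_depth i : step i - depth i <= lam - i%:R.
Proof.
have l4 := lam4; have lr := lam_rr.
elim: i => [|i IH].
  by rewrite /depth big_ord0 /step expr0 !subr0 ge_min; apply/orP; right; lra.
by rewrite depthS -natr1; have := stepS i; lra.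
Qed.

(** About [log2 y] levels of doubling bring the steps to the cap, after which every level adds
    [rr]. *)
Lemma depth_low y j s : rr = y * lam -> 2 ^+ j <= y < 2 ^+ j.+1 ->
  (s%:R + 1) * rr <= depth (j + 2 + s).
Proof.
have l4 := lam4; have lr := lam_rr.
move=> rrE /andP[jy yj].
(* From [4 <= lam] comes [3 / 4 * lam <= lam - 1]. *)
have step34 i : 3 / 4 * Num.min rr (2 ^+ i * lam) <= step i.
  have p0 : 0 <= 2 ^+ i :> R by rewrite exprn_ge0.
  rewrite le_min; apply/andP; split.
    by apply: (@le_trans _ _ (3 / 4 * rr)); [rewrite ler_pM2l ?ge_min ?lexx //; lra | lra].
  apply: (@le_trans _ _ (3 / 4 * (2 ^+ i * lam))); last nra.
  by rewrite ler_pM2l ?ge_min ?lexx ?orbT //; lra.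
have low i : (i <= j.+1)%N -> 3 / 4 * (2 ^+ i - 1) * lam <= depth i.
  elim: i => [_|i IH ij]; first by rewrite /depth big_ord0 expr0 subrr mulr0 mul0r.
  rewrite depthS; have := IH (ltnW ij); have := step34 i; rewrite (min_idPr _).
    by rewrite exprS; nra.
  have : 2 ^+ i <= 2 ^+ j :> R by rewrite ler_weXn2l //; lra.
  by rewrite rrE => ?; rewrite ler_pM2r; lra.
have P1 : 1 <= 2 ^+ j :> R by rewrite exprn_ege1 //; lra.
have d1 := low _ (leqnn j.+1).
have d2 : rr <= depth (j + 2).
  rewrite addn2 depthS; have := step34 j.+1; rewrite (min_idPl _); last first.
    by rewrite rrE ler_pM2r; lra.
  rewrite rrE; move: yj d1; rewrite exprS; nra.
elim: s => [|s IH]; first by rewrite addn0 add0r mul1r.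
rewrite addnS depthS -natr1.
have : rr <= step (j + 2 + s); last by lra.
rewrite le_min lexx /=; apply: (@le_trans _ _ (2 ^+ (j + 2) * (lam - 1) + 1)).
  by rewrite rrE exprD; move: yj; rewrite exprS; nra.
rewrite lerD2r ler_pM2r ?ler_weXn2l ?leq_addr //; lra.
Qed.

End Exponents.
End Numerics.

(** * Sampling probabilities, level sizes and the number of hopset edges *)

Section LevelSizes.
Variable R : realType.
Local Open Scope ring_scope.
Variables (m : nat) (kappa rho : R).
Hypotheses (kappa2 : 2 <= kappa) (kappa_m : kappa <= log2 (m%:R : R) / 4).
Hypotheses (rho_half : rho < 1 / 2) (kappa_rho : 1 / kappa <= rho).

Let lm : R := log2 m%:R.
Let lam : R := lm / kappa.
Let rr : R := rho * lm.

Definition level_target i : R := 2 `^ (lm - depth lam rr i).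
Definition level_prob i : R := 2 `^ (- step lam rr i) / 3.
Definition level_top : nat := Num.trunc (log2 kappa + 1 / rho).
Definition level_k : nat := (Num.trunc (3 * m%:R `^ rho * ln (8 * m%:R) : R)).+2.

Lemma params_facts :
  [/\ 8 <= lm, 4 <= lam, lam <= rr, 0 < rho & 1 <= rho * kappa] /\
  [/\ lm = kappa * lam, rr = rho * kappa * lam & (0 < m)%N].
Proof.
have k0 : 0 < kappa by have := kappa2; lra.
have k1 : 0 < kappa^-1 by rewrite invr_gt0.
have lm8 : 8 <= lm by have := kappa_m; have := kappa2; rewrite -/lm; lra.
have r0 : 0 < rho by have := kappa_rho; lra.
have rk : 1 <= rho * kappa.
  by rewrite -ler_pdivrMr //; exact: kappa_rho.
have lmE : lm = kappa * lam by rewrite /lam mulrCA mulfV ?mulr1 // gt_eqF.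
have l4 : 4 <= lam by rewrite ler_pdivlMr //; have := kappa_m; rewrite -/lm; lra.
have rrE : rr = rho * kappa * lam by rewrite /rr lmE mulrA.
do !split=> //.
  by rewrite rrE ler_peMl //; lra.
rewrite lt0n; apply/eqP => m0; have := lm8; rewrite /lm /log2 m0 ln0 // mul0r; lra.
Qed.

Let m0 : 0 < m%:R :> R.
Proof. by have [_ [_ _ ?]] := params_facts; rewrite ltr0n. Qed.

Lemma m_powR x : m%:R `^ x = 2 `^ (x * lm) :> R.
Proof. exact: powR_log2. Qed.

Lemma m_powE : m%:R = 2 `^ lm :> R.
Proof. by rewrite powR2_log2. Qed.

Lemma level_prob01 i : 0 < level_prob i <= 1.
Proof.
have [[_ l4 lr _ _] _] := params_facts.
apply/andP; split; first by rewrite divr_gt0 ?powR_gt0.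
have := @powR2_le _ (- step lam rr i) 0; rewrite powRr0 => h.
have s1 := step_ge1 l4 lr i; have := h (ltac:(lra)); rewrite /level_prob; lra.
Qed.

Lemma level_targetS i : 3 * level_prob i * level_target i <= level_target i.+1.
Proof.
rewrite /level_prob /level_target depthS mulrCA mulfV // mulr1 -powR2D.
by apply: powR2_le; lra.
Qed.

Lemma level_target0 : m%:R <= level_target 0.
Proof. by rewrite /level_target /depth big_ord0 subr0 -m_powE. Qed.

Lemma ln8m : 1 <= ln (8 * m%:R : R) <= 2 * lm.
Proof.
have [[lm8 _ _ _ _] _] := params_facts.
have /andP[l1 l2] := @ln2_bounds R.
have -> : ln (8 * m%:R : R) = (3 + lm) * ln 2.
  have -> : (3 : R) = log2 (2 ^+ 3) by rewrite log2X.
  rewrite -log2M //.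
  have -> : 2 ^+ 3 = 8 :> R by rewrite !exprS expr0; lra.
  by rewrite /log2 divfK // gt_eqF //; lra.
by apply/andP; split; nra.
Qed.

Lemma level_k_bounds :
  3 * m%:R `^ rho * ln (8 * m%:R) < (level_k.-1)%:R :> R /\
  (level_k)%:R <= 7 * (m%:R `^ rho * lm) :> R.
Proof.
have [[lm8 _ _ r0 _] _] := params_facts; have /andP[h1 h2] := ln8m.
have p1 : 1 <= m%:R `^ rho :> R.
  by rewrite m_powR powR2_ge1 // mulr_ge0 //; lra.
split; first exact: truncnS_gt.
have : (Num.trunc (3 * m%:R `^ rho * ln (8 * m%:R) : R))%:R <= 3 * m%:R `^ rho * ln (8 * m%:R) :> R.
  by rewrite truncn_le !mulr_ge0 //; lra.
rewrite /level_k -addn2 natrD; set p := _ `^ _ in p1 *.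
have a1 : p * ln (8 * m%:R) <= p * (2 * lm) by rewrite ler_pM2l //; lra.
have a2 : lm <= p * lm by rewrite ler_peMl //; lra.
lra.
Qed.

Lemma level_prob_k i : 4 * m%:R * (1 - level_prob i) ^+ level_k < 1.
Proof.
have /andP[p0 p1] := level_prob01 i; have [hk _] := level_k_bounds.
have /andP[h1 _] := ln8m.
have pk : ln (8 * m%:R) <= level_prob i * level_k%:R.
  apply: (@le_trans _ _ (level_prob i * (3 * m%:R `^ rho * ln (8 * m%:R)))).
    have -> : level_prob i * (3 * m%:R `^ rho * ln (8 * m%:R)) =
        2 `^ (- step lam rr i + rr) * ln (8 * m%:R).
      by rewrite powR2D /level_prob m_powR -/rr; field.
    rewrite ler_peMl //; first lra.
    by apply: powR2_ge1; have := step_le lam rr i; lra.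
  rewrite ler_pM2l //; apply: (le_trans (ltW hk)).
  by rewrite ler_nat leq_pred.
apply: (@le_lt_trans _ _ (4 * m%:R * expR (- ln (8 * m%:R)))).
  apply: ler_wpM2l; first by rewrite mulr_ge0 // ltW.
  apply: (@le_trans _ _ (expR (- level_prob i) ^+ level_k)).
    apply: lerXn2r; rewrite ?nnegrE ?expR_ge0 ?subr_ge0 //.
    exact: expR_ge1Dx.
  by rewrite -expRM_natr ler_expR; lra.
rewrite expRN lnK ?posrE ?mulr_gt0 //.
have -> : 4 * m%:R / (8 * m%:R) = 1 / 2 :> R by field; rewrite gt_eqF.
lra.
Qed.

Lemma level_topP : level_top%:R <= log2 kappa + 1 / rho < level_top%:R + 1.
Proof.
have [[_ _ _ r0 _] _] := params_facts.
rewrite natr1 truncn_itv //; apply: addr_ge0; last by rewrite divr_ge0 // ltW.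
by have := @log2_mono R 1 kappa; rewrite {1}/log2 ln1 mul0r; apply; have := kappa2; lra.
Qed.

(** The term [log2 kappa] of [level_top] pays for the doubling levels, the term [1 / rho] for the
    levels that add [rr = rho * lm] each. *)
Lemma level_depth_top : lm - rr <= depth lam rr level_top.
Proof.
have [[lm8 l4 lr r0 rk] [lmE rrE _]] := params_facts.
have /andP[_ top_gt] := level_topP.
have [j jP] := pow2_between rk; have /andP[j1 j2] := jP.
(* As [rho < 1 / 2], one has [2 ^+ j.+1 <= 2 * rho * kappa <= kappa]. *)
have jk : j%:R + 1 <= log2 kappa.
  rewrite natr1 -log2X; apply: log2_mono; first by rewrite exprn_gt0.
  rewrite exprS; have := rho_half; have := kappa2; nra.
have ir : 2 < 1 / rho by rewrite ltr_pdivlMr //; have := rho_half; lra.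
have jt : (j + 2 <= level_top)%N.
  by rewrite -ltnS -(ltr_nat R) natrD -natr1; lra.
have := depth_low l4 lr (level_top - (j + 2)) rrE jP.
rewrite subnKC // natrB // natrD; apply: le_trans.
have -> : lm - rr = (1 / rho - 1) * rr by rewrite /rr; field; rewrite gt_eqF.
by rewrite ler_pM2r; lra.
Qed.

Lemma level_target_top : level_target level_top <= m%:R `^ rho.
Proof. by rewrite m_powR; apply: powR2_le; have := level_depth_top; rewrite -/rr; lra. Qed.

Lemma level_target_top_k : level_target level_top < level_k%:R.
Proof.
apply: le_lt_trans level_target_top _; have [hk _] := level_k_bounds.
have /andP[h1 _] := ln8m; have p0 : 0 <= m%:R `^ rho :> R by exact: powR_ge0.
have : (level_k.-1)%:R <= level_k%:R :> R by rewrite ler_nat leq_pred.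
have : 0 <= m%:R `^ rho * (ln (8 * m%:R) - 1) :> R by rewrite mulr_ge0 //; lra.
lra.
Qed.

Lemma level_edge_bound :
  edge_bound level_prob level_target level_top +
    level_target level_top * (level_target level_top + 1) <=
  26 * m%:R `^ (1 + 1 / kappa).
Proof.
have [[lm8 l4 lr r0 rk] [lmE rrE _]] := params_facts.
have k0 : 0 < kappa by have := kappa2; lra.
set q : R := m%:R `^ (1 + 1 / kappa).
have qE : q = 2 `^ (lm + lam).
  by rewrite /q m_powR mulrDl !mul1r [_ * lm]mulrC.
have b1 : edge_bound level_prob level_target level_top <= 24 * q.
  apply: (@le_trans _ _ (\sum_(j < level_top) 12 * q * (1 / 2) ^+ j)).
    apply: ler_sum => j _.
    have /andP[p0 p1] := level_prob01 j.
    have t0 : 0 < level_target j by exact: powR_gt0.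
    apply: (@le_trans _ _ (4 * (level_target j / level_prob j))).
      have : level_target j <= level_target j / level_prob j.
        by rewrite ler_pdivlMr // ler_piMr // ltW.
      by rewrite -mulrA; lra.
    have -> : level_target j / level_prob j = 3 * 2 `^ (lm - depth lam rr j + step lam rr j).
      rewrite powR2D /level_target /level_prob powRN; field.
      by rewrite gt_eqF ?powR_gt0.
    rewrite mulrA -[4 * 3]natrM -[12 * q * _]mulrA; apply: ler_wpM2l => //.
    have -> : q * (1 / 2) ^+ j = 2 `^ (lm + lam - j%:R).
      rewrite powR2D powRN powR_mulrn // qE; congr (_ * _).
      by rewrite expr_div_n expr1n div1r.
    by apply: powR2_le; have := step_depth l4 lr j; lra.
  rewrite -mulr_sumr.
  have : \sum_(j < level_top) (1 / 2 : R) ^+ j <= 2.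
    elim: level_top => [|n IH]; first by rewrite big_ord0.
    rewrite big_ord_recl expr0.
    under eq_bigr do rewrite lift0 exprS.
    by rewrite -mulr_sumr; lra.
  have q0 : 0 <= q by exact: powR_ge0.
  by move=> /(ler_wpM2l q0); lra.
have b2 : level_target level_top * (level_target level_top + 1) <= 2 * q.
  set T := level_target level_top.
  have T0 : 0 <= T by exact: powR_ge0.
  have Tm := level_target_top; rewrite -/T in Tm.
  have p1 : 1 <= m%:R `^ rho :> R by rewrite m_powR powR2_ge1 // mulr_ge0 //; lra.
  apply: (@le_trans _ _ (m%:R `^ rho * (2 * m%:R `^ rho))).
    by apply: ler_pM => //; lra.
  rewrite mulrCA ler_pM2l // !m_powR -powR2D qE; apply: powR2_le.
  by rewrite -/rr; have := rho_half; rewrite /rr; nra.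
lra.
Qed.

End LevelSizes.

(** * Growth of the hop bounds *)

Lemma chain_hops_le N i j : 0 < N -> i <= j ->
  chain_hops (hops N i) (stop_count N i) <= chain_hops (hops N j) (stop_count N j).
Proof.
move=> N0 ij; rewrite /chain_hops; apply: leq_mul.
  by case: i j ij => [|i] [|j] //= _; lia.
suff mono d : hops N i <= hops N (i + d) by rewrite ltnS -(subnKC ij).
elim: d => [|d IH]; first by rewrite addn0.
by rewrite addnS; apply: (leq_trans IH); rewrite /= /chain_hops; nia.
Qed.

Lemma hopsS N i :
  hops N i.+1 = (2 * chain_hops (hops N i) (stop_count N i)).+1.
Proof. by []. Qed.

Lemma chain_hops_le_hops N i :
  chain_hops (hops N i) (stop_count N i) <= hops N i.+1.
Proof. by rewrite hopsS; lia. Qed.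

(** Adding one to [hops] makes the recurrence multiplicative, with ratio at most [10 * N]; the first
    value is 10. *)
Lemma hops_bound N i : 0 < N -> (hops N i.+1).+1 <= 10 * (10 * N) ^ i.
Proof.
move=> N0; elim: i => [//|i IH].
have -> : (hops N i.+2).+1 = 2 * ((2 * N + 2) * (hops N i.+1).+1) + 2 by rewrite /= /chain_hops; lia.
rewrite expnS [10 * (_ * _)]mulnCA; apply: leq_trans (leq_mul (leqnn _) IH); nia.
Qed.

(** * Expectation and probability over trivial seeds *)

Section Deterministic.
Variables (R : realType) (B : publication) (P T : nat) (V : finType).
Let A := flood_alg R B P T.

Lemma card_unit_seeds : #|{: seeds A V}| = 1.
Proof. by rewrite card_ffun card_unit exp1n. Qed.

Lemma unit_seeds_prob (s : seeds A V) : (seeds_prob s = 1)%R.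
Proof. by rewrite /seeds_prob big1. Qed.

Lemma Expect_unit (x : R) : Expect (fun _ : seeds A V => x) = x.
Proof.
rewrite /Expect (eq_bigr (fun=> x)); last by move=> s _; rewrite unit_seeds_prob mul1r.
by rewrite sumr_const card_unit_seeds mulr1n.
Qed.

Lemma Prob_unit (Ev : seeds A V -> Prop) : (forall s, Ev s) -> Prob Ev = 1%R.
Proof.
move=> all_s; rewrite /Prob (eq_bigl xpredT); last by move=> s; apply/asboolP.
rewrite (eq_bigr (fun=> 1%R)); last by move=> s _; exact: unit_seeds_prob.
by rewrite sumr_const card_unit_seeds.
Qed.

End Deterministic.

(** * Hop bound and round bound *)

Section Budget.
Variable R : realType.
Local Open Scope ring_scope.
Variables (m D : nat) (kappa rho t L eps : R).
Hypotheses (kappa2 : 2 <= kappa) (kappa_m : kappa <= log2 (m%:R : R) / 4).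
Hypotheses (rho_half : rho < 1 / 2) (kappa_rho : 1 / kappa <= rho).
Hypotheses (t1 : 1 <= t) (tL : t <= L) (eps0 : 0 < eps) (eps1 : eps < 1).

Let e : R := log2 kappa + 1 / rho.
Let top := level_top kappa rho.

Definition error_scale : nat := (Num.trunc (4 * e / eps)).+1.
Let N := error_scale.
Definition level_rounds_bound : nat := chain_hops (hops N top) (stop_count N top).
(** The factor [top.+1] lets the hop bound absorb the total number of phases, which is counted with
    [level_rounds_bound] for each of the [top.+1] levels. *)
Definition hopbound : nat := (top.+1 * hops N top.+1)%N.

Let e_ge2 : 2 <= e /\ 1 <= e / eps.
Proof.
have [[_ _ _ r0 _] _] := params_facts kappa2 kappa_m kappa_rho.
have ir : 2 < 1 / rho by rewrite ltr_pdivlMr //; have := rho_half; lra.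
have lk : 0 <= log2 kappa.
  by have := @log2_mono R 1 kappa; rewrite {1}/log2 ln1 mul0r; apply; have := kappa2; lra.
have e2 : 2 <= e by rewrite /e; lra.
by split=> //; rewrite ler_pdivlMr // mul1r; have := eps1; lra.
Qed.

Let top_facts : (0 < top)%N /\ top%:R <= e.
Proof.
have /andP[h1 h2] := level_topP kappa2 kappa_m kappa_rho.
have [e2 _] := e_ge2; split=> //.
by rewrite -(ltr_nat R); move: h2 e2; rewrite -/top -/e; lra.
Qed.

Lemma error_scaleP : 4 * e / eps < N%:R <= 5 * (e / eps).
Proof.
have [_ ee] := e_ge2; rewrite truncnS_gt /N /error_scale -addn1 natrD.
have : (Num.trunc (4 * e / eps))%:R <= 4 * e / eps by rewrite truncn_le; lra.
lra.
Qed.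

Lemma error_scale_top : (4 * top <= N)%N.
Proof.
have /andP[h _] := error_scaleP; have [_ he] := top_facts; have [e2 _] := e_ge2.
rewrite -(ler_nat R) natrM ltW //; apply: le_lt_trans h.
rewrite ler_pdivlMr //; have : top%:R * eps <= e * 1 by apply: ler_pM => //; exact: ltW.
lra.
Qed.

Lemma error_scale_eps : ((N + 4 * top)%:R <= (1 + eps) * N%:R :> R).
Proof.
have /andP[h _] := error_scaleP; have [_ he] := top_facts.
by move: h; rewrite ltr_pdivrMr // natrD natrM; lra.
Qed.

(** With [top.+1 <= 2 ^ top] and [10 <= 10 ^ top], the bound becomes [(200 * N) ^ top]. Then
    [N <= 5 * (e / eps)] gives the constant 1000, and [t <= L] inserts the factor [L / t]. *)
Lemma hopbound_le : hopbound%:R <= (1000 * (e * L / (eps * t))) `^ e.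
Proof.
have /andP[_ hN] := error_scaleP; have [tp he] := top_facts; have [e2 ee] := e_ge2.
have t0 : 0 < t by have := t1; lra.
have X1 : e / eps <= e * L / (eps * t).
  have -> : e * L / (eps * t) = e / eps * (L / t) by field; rewrite !gt_eqF.
  by rewrite ler_peMr ?ler_pdivlMr ?mul1r //; lra.
set X := e * L / _ in X1 *.
have XN : 200 * N%:R <= 1000 * X by lra.
apply: (@le_trans _ _ ((1000 * X) `^ top%:R)); last first.
  by apply: ler_powR => //; lra.
rewrite powR_mulrn; last by lra.
apply: (@le_trans _ _ ((200 * N%:R) ^+ top)); last first.
  have N0 : 0 <= 200 * N%:R :> R by exact: (mulr_ge0 (ler0n R 200) (ler0n R N)).
  have X0 := le_trans N0 XN.
  by apply: lerXn2r XN; rewrite nnegrE.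
rewrite -natrM -natrX ler_nat /hopbound.
have hb := @hops_bound N top isT.
apply: (@leq_trans (2 ^ top * (10 ^ top * (10 * N) ^ top))%N); last first.
  have -> : (200 * N = 2 * (10 * (10 * N)))%N by rewrite !mulnA.
  by rewrite (expnMn 2) (expnMn 10 (10 * N)) leqnn.
apply: leq_mul; first exact: ltn_expl.
apply: leq_trans (leq_trans (leqnSn _) hb) _; rewrite leq_mul2r; apply/orP; right.
by rewrite -[X in (X <= _)%N]expn1 leq_exp2l.
Qed.

Lemma rounds_le :
  ((top.+1 * level_rounds_bound) * (D + m * level_k m rho + 2))%:R <=
  1000 * ((D%:R + m%:R `^ (1 + rho) * log2 m%:R * t) * (hopbound%:R / rho) * L *
    (2 `^ t / t)) :> R.
Proof.
have [[lm8 _ _ r0 _] [_ _ m0]] := params_facts kappa2 kappa_m kappa_rho.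
have [_ kb] := level_k_bounds kappa2 kappa_m kappa_rho.
have t0 : 0 < t by have := t1; lra.
have hb : (top.+1 * level_rounds_bound <= hopbound)%N.
  exact: leq_mul (leqnn _) (chain_hops_le_hops _ _).
have m1 : 1 <= m%:R :> R by rewrite ler1n.
set M := m%:R `^ (1 + rho) * log2 m%:R.
have ME : M = m%:R * (m%:R `^ rho * log2 m%:R).
  by rewrite /M powRD ?powRr1 ?mulrA //; apply/implyP => _; rewrite gt_eqF //; lra.
have p1 : 1 <= m%:R `^ rho :> R.
  by rewrite powR_log2 ?ltr0n // powR2_ge1 // mulr_ge0 //; lra.
have M1 : 8 <= M.
  rewrite ME; apply: (@le_trans _ _ (1 * (1 * 8))); first lra.
  by apply: ler_pM => //; apply: ler_pM.
have phase : (D + m * level_k m rho + 2)%:R <= 8 * (D%:R + M * t) :> R.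
  rewrite !natrD natrM; have : m%:R * (level_k m rho)%:R <= 7 * M.
    by rewrite ME mulrCA ler_pM2l //; lra.
  have : M <= M * t by rewrite ler_peMr //; lra.
  have : 0 <= D%:R :> R by [].
  lra.
have DM0 : 0 <= D%:R + M * t by rewrite addr_ge0 // mulr_ge0 //; lra.
have b0 : 0 <= hopbound%:R :> R by [].
have f1 : 1 <= rho^-1 * L * (2 `^ t / t).
  apply: mulr_ege1; last by rewrite ler_pdivlMr // mul1r powR2_ge // ltW.
  apply: mulr_ege1; last by have := t1; have := tL; lra.
  by rewrite invf_ge1 //; have := rho_half; lra.
rewrite natrM; apply: (@le_trans _ _ (hopbound%:R * (8 * (D%:R + M * t)))).
  by apply: ler_pM => //; rewrite ler_nat.
have -> : 1000 * ((D%:R + M * t) * (hopbound%:R / rho) * L * (2 `^ t / t)) =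
    (hopbound%:R * (D%:R + M * t)) * 1000 * (rho^-1 * L * (2 `^ t / t)) by ring.
rewrite mulrCA; set Y := hopbound%:R * _.
have Y0 : 0 <= Y by exact: mulr_ge0.
apply: (@le_trans _ _ (Y * 1000)); first lra.
exact: (ler_peMr (mulr_ge0 Y0 (ler0n R 1000)) f1).
Qed.

End Budget.

(** * Assembly of the algorithm *)

Local Open Scope ring_scope.

Theorem theorem3p13 (R : realType) :
  exists (W : nat) (C c : R), 0 < C /\ 0 < c /\
  forall (m D Lam : nat) (kappa rho t eps : R),
    2 <= kappa -> kappa <= log2 (m%:R : R) / 4 ->
    rho < 1 / 2 -> 1 / kappa <= rho ->
    1 <= t -> t <= log2 (Lam%:R : R) ->
    0 < eps -> eps < 1 ->
  exists (beta : nat) (A : congest_alg R),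
    beta%:R <= (C * ((log2 kappa + 1 / rho) * log2 Lam%:R / (eps * t)))
                 `^ (log2 kappa + 1 / rho) /\
  forall (V : finType) (id : V -> nat) (G : wgraph V)
         (Vt : {set V}) (Gt : wgraph V),
    injective id ->
    diameter R G = Lam%:R%:E -> hop_diameter R G = D%:R%:E ->
    graph_on Vt Gt -> #|Vt| = m ->
    respects_bandwidth A id G Vt Gt W /\
    exists H : seeds A V -> wgraph V,
      (forall s : seeds A V,
         hopset beta eps Vt Gt (H s) /\
         exists r : nat, computed_by id G Vt Gt s r (H s)) /\
      Expect (fun s : seeds A V => #|edges (H s)|%:R)
        <= C * (m%:R `^ (1 + 1 / kappa) * log2 Lam%:R) /\
      Prob (fun s : seeds A V => exists r : nat,
              r%:R <= C * ((D%:R + m%:R `^ (1 + rho) * log2 m%:R * t)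
                           * (beta%:R / rho) * log2 Lam%:R * (2 `^ t / t)) /\
              computed_by id G Vt Gt s r (H s))
        >= 1 - m%:R `^ (- c).
Proof.
(* A message is one fact, that is, two identities and a weight. The constant 1000 is the one of
   [hopbound_le] and [rounds_le]. *)
exists 3, 1000, 1; split; first by rewrite (ltr0n R 1000).
split; first exact: ltr01.
move=> m D Lam kappa rho t eps.
move=> kappa2 kappa_m rho_half kappa_rho t1 tL eps0 eps1.
pose top := level_top kappa rho.
pose N := error_scale kappa rho eps.
pose h := level_rounds_bound kappa rho eps.
pose k := level_k m rho.
pose prob := level_prob m kappa rho.
pose P := (top.+1 * h)%N.
pose T := (D + m * k + 2)%N.
pose B := hopset_pub k h top prob.
exists (hopbound kappa rho eps), (flood_alg R B P T); split.
  exact: hopbound_le kappa2 kappa_m rho_half kappa_rho t1 tL eps0 eps1.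
move=> V id G Vt Gt id_inj _ hopD Gt_on Vt_m; split; first exact: flood_bandwidth.
have nN : (4 * top <= N)%N.
  exact: error_scale_top kappa2 kappa_m rho_half kappa_rho eps0 eps1.
have h0 : (0 < h)%N.
  by rewrite /h /level_rounds_bound /chain_hops addn2.
have hl i : (i <= top)%N -> (chain_hops (hops N i) (stop_count N i) <= h)%N.
  by move=> it; apply: chain_hops_le.
have p01 : forall i, 0 < prob i <= 1 by exact: level_prob01.
have pk i : (i < top)%N -> 4 * #|Vt|%:R * (1 - prob i) ^+ k < 1.
  by rewrite Vt_m => _; exact: level_prob_k.
have tS i : (i < top)%N ->
    3 * prob i * level_target m kappa rho i <= level_target m kappa rho i.+1.
  by move=> _; exact: level_targetS.
have tm : #|Vt|%:R <= level_target m kappa rho 0 by rewrite Vt_m; exact: level_target0.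
have tk : level_target m kappa rho top < k%:R by exact: level_target_top_k.
have [sound sizeE hop] :=
  final_edges_spec (isT : (1 < k)%N) (isT : (0 < N)%N) nN h0 hl
    id_inj Gt_on p01 pk tS tm tk.
pose H := list_graph sound.
have comp (s : seeds (flood_alg R B P T) V) : computed_by id G Vt Gt s (P * T)%N H.
  move=> v; rewrite table_list_graph //.
  apply: (@flood_output_public R B P T V id G Vt Gt s D k).
  - move=> u uVt; case e: (table _ _) => [//|x l].
    have /mem_table[w _ uw] : x \in table id (Gt u) by rewrite e mem_head.
    by have := Gt_on u w; rewrite /adj uw (negbTE uVt) => /(_ isT).
  - exact: size_level_sel.
  - exact: hop_diameter_ball hopD.
  - by rewrite Vt_m.
exists (fun=> H); split; last split.
- move=> s; split; last by exists (P * T)%N.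
  apply: (list_hopset id_inj sound (N := N) (M := N + 4 * top)%N).
  - by [].
  - exact: eps0.
  - exact: error_scale_eps kappa2 kappa_m rho_half kappa_rho eps0 eps1.
  - move=> j x y len /hop[l r le_l]; exists l => //; apply: reach_le r => //.
    exact: leq_pmull.
- rewrite Expect_unit; set q := m%:R `^ _.
  have q0 : 0 <= q by exact: powR_ge0.
  have le26 : #|edges H|%:R <= 26 * q.
    apply: le_trans (level_edge_bound kappa2 kappa_m rho_half kappa_rho).
    by apply: le_trans sizeE; rewrite ler_nat card_edges_list.
  (* The size bound holds without the logarithm, which is at least [t] and hence at least 1. *)
  have qL : q <= q * log2 Lam%:R by rewrite ler_peMr //; lra.
  apply: (le_trans le26); lra.
(* The algorithm is deterministic, so the round bound holds with probability 1. *)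
- rewrite Prob_unit.
    by rewrite lerBlDr lerDl powR_ge0.
  move=> s; exists (P * T)%N; split; last exact: comp.
  exact: rounds_le.
Qed.
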